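(* There exist infinitely many pairwise conformally inequivalent integral crystallographic packings.
   Context: Let $n\ge 2$ and $\widehat{\mathbb{R}^n}=\mathbb{R}^n\cup\{\infty\}$, identified with the boundary at infinity $\partial\mathbb{H}^{n+1}$ of hyperbolic $(n+1)$-space; $\mathrm{Isom}(\mathbb{H}^{n+1})$ acts on $\widehat{\mathbb{R}^n}$ by Möbius transformations (orientation preserving or reversing). An oriented $(n-1)$-sphere (codimension-one planes are allowed) is a sphere together with a choice of one of its two complementary components in $\widehat{\mathbb{R}^n}$ as its (open) interior. An $S^{n-1}$-packing (or packing, of dimension $n$) $\mathcal{P}$ of $\widehat{\mathbb{R}^n}$ is an infinite collection of oriented $(n-1)$-spheres or codimension-one planes such that (i) the interiors of the spheres are disjoint, and (ii) any ball in $\widehat{\mathbb{R}^n}$ intersects the interior of some sphere in $\mathcal{P}$. The bend of a sphere is the reciprocal of its signed radius (positive if the interior is the bounded component, negative if the interior is the unbounded component; planes have bend $0$). A packing is integral if every sphere in it has integer bend. A reflection group is a discrete subgroup of $\mathrm{Isom}(\mathbb{H}^{n+1})$ generated by reflections in hyperplanes. It is geometrically finite if some uniform thickening of its convex core has finite volume. The limit set of a packing $\mathcal{P}$ is the set of limit points of $\mathcal{P}$, i.e. points of $\widehat{\mathbb{R}^n}$ every neighborhood of which meets infinitely many spheres of $\mathcal{P}$. A packing is crystallographic if its limit set equals the limit set of some geometrically finite reflection group $\Gamma<\mathrm{Isom}(\mathbb{H}^{n+1})$. Two packings of $\widehat{\mathbb{R}^n}$ are conformally equivalent if one is the image of the other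 under a (conformal or anticonformal) Möbius transformation of $\widehat{\mathbb{R}^n}$; packings of different dimensions are inequivalent. *)

(* Defs.v *)
From HB Require Import structures.
From mathcomp Require Import all_boot all_order all_algebra.
From mathcomp Require Import all_classical all_reals all_analysis.
Import Order.TTheory GRing.Theory Num.Theory.
Import numFieldNormedType.Exports.

Set Implicit Arguments.
Unset Strict Implicit.
Unset Printing Implicit Defensive.

Local Open Scope classical_set_scope.
Local Open Scope ring_scope.

(* R^m together with a point at infinity, as a topological space. *)
Notation Rhat R m := (one_point_compactification 'rV[R]_m).

Definition pt (R : realType) (m : nat) (x : 'rV[R]_m) : Rhat R m := Some x.
Definition infty (R : realType) (m : nat) : Rhat R m := None.
Arguments infty {R m}.

(* The norm provided by the library on 'rV[R]_m is the sup norm, hence the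
   explicit Euclidean structure. *)
Definition dot (R : realType) (m : nat) (x y : 'rV[R]_m) : R :=
  \sum_(i < m) x 0 i * y 0 i.
Definition enorm (R : realType) (m : nat) (x : 'rV[R]_m) : R :=
  Num.sqrt (dot x x).

Definition sphere_inversion (R : realType) (m : nat) (a : 'rV[R]_m) (r : R)
    (z : Rhat R m) : Rhat R m :=
  match z with
  | Some x => if x == a then infty
              else pt (a + (r ^+ 2 / enorm (x - a) ^+ 2) *: (x - a))
  | None => pt a
  end.

(* Reflection in the plane of equation dot u x = c, where u != 0. *)
Definition plane_reflection (R : realType) (m : nat) (u : 'rV[R]_m) (c : R)
    (z : Rhat R m) : Rhat R m :=
  match z with
  | Some x => pt (x - (2 * (dot u x - c) / enorm u ^+ 2) *: u)
  | None => infty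
  end.

(* The group of bijections of T generated by a set S of bijections of T. *)
Inductive gen_group (T : Type) (S : set (T -> T)) : (T -> T) -> Prop :=
| gen_group_id : gen_group S id
| gen_group_mem f : S f -> gen_group S f
| gen_group_comp f g : gen_group S f -> gen_group S g -> gen_group S (f \o g)
| gen_group_inv f g :
    gen_group S f -> cancel f g -> cancel g f -> gen_group S g.

Definition reflection (R : realType) (m : nat) (f : Rhat R m -> Rhat R m) :=
  (exists a r, 0 < r /\ f = sphere_inversion a r) \/
  (exists u c, u != 0 /\ f = plane_reflection u c).

(* All the Moebius transformations, orientation preserving or reversing. *)
Definition moebius (R : realType) (m : nat) : set (Rhat R m -> Rhat R m) :=
  gen_group (@reflection R m).

(* A pair (S, I) where S is a sphere or a plane and I is the component of its
   complement that is chosen as interior. *)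
Definition oriented (R : realType) (n : nat) : Type :=
  (set (Rhat R n) * set (Rhat R n))%type.
Definition carrier (R : realType) (n : nat) (D : oriented R n) := D.1.
Definition inside (R : realType) (n : nat) (D : oriented R n) := D.2.

(* [has_bend D b]: D is an oriented sphere (or plane) of bend b. Planes contain
   infty; both orientations of a plane are obtained by changing (u, c) into
   (- u, - c). *)
Inductive has_bend (R : realType) (n : nat) : oriented R n -> R -> Prop :=
| bounded_interior (a : 'rV[R]_n) (r : R) : 0 < r ->
    has_bend (@pt R n @` [set x | enorm (x - a) = r],
              @pt R n @` [set x | enorm (x - a) < r]) r^-1
| unbounded_interior (a : 'rV[R]_n) (r : R) : 0 < r ->
    has_bend (@pt R n @` [set x | enorm (x - a) = r],
              infty |` @pt R n @` [set x | enorm (x - a) > r]) (- r^-1)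
| half_space_interior (u : 'rV[R]_n) (c : R) : u != 0 ->
    has_bend (infty |` @pt R n @` [set x | dot u x = c],
              @pt R n @` [set x | dot u x > c]) 0.

Definition oriented_sphere (R : realType) (n : nat) (D : oriented R n) :=
  exists b, has_bend D b.

(* The balls of Rhat R n are the interiors of the oriented spheres. *)
Definition packing (R : realType) (n : nat) (P : set (oriented R n)) :=
  [/\ infinite_set P,
      P `<=` @oriented_sphere R n,
      trivIset P (@inside R n) &
      forall B, oriented_sphere B ->
        exists2 D, P D & inside B `&` inside D !=set0].

Definition integral_packing (R : realType) (n : nat) (P : set (oriented R n)) :=
  forall D, P D -> exists b : int, has_bend D b%:~R.

Definition packing_limit_set (R : realType) (n : nat)
    (P : set (oriented R n)) : set (Rhat R n) :=
  [set z | forall U, nbhs z U ->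
     infinite_set (P `&` [set D | carrier D `&` U !=set0])].

(* Hyperbolic (n+1)-space is the upper half-space of 'rV[R]_(n + 1), the last
   coordinate being the height; its boundary at infinity is the image of
   Rhat R n under [ideal]. Isometries are represented by their Poincare
   extensions, which are Moebius transformations of Rhat R (n + 1). *)
Definition height (R : realType) (n : nat) (p : 'rV[R]_(n + 1)) : R :=
  p 0 (rshift n ord0).
Definition uhs (R : realType) (n : nat) : set 'rV[R]_(n + 1) :=
  [set p | 0 < height p].
Definition ideal (R : realType) (n : nat) (z : Rhat R n) : Rhat R (n + 1) :=
  match z with
  | Some x => pt (row_mx x 0)
  | None => infty
  end.

Definition arcosh (R : realType) (x : R) : R :=
  ln (x + Num.sqrt (x ^+ 2 - 1)).
Definition hdist (R : realType) (n : nat) (p q : 'rV[R]_(n + 1)) : R :=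
  arcosh (1 + enorm (p - q) ^+ 2 / (2 * height p * height q)).

(* The hyperplanes of the upper half-space are the hemispheres centered on the
   boundary and the vertical planes. *)
Definition hyperbolic_reflection (R : realType) (n : nat)
    (f : Rhat R (n + 1) -> Rhat R (n + 1)) :=
  (exists (a : 'rV[R]_n) (r : R),
     0 < r /\ f = sphere_inversion (row_mx a 0) r) \/
  (exists (u : 'rV[R]_n) (c : R),
     u != 0 /\ f = plane_reflection (row_mx u 0) c).

(* The identity is isolated in G for the compact-open topology. Elements of G
   preserve the upper half-space, so that g (pt p) is always of the form pt q
   when p is in K. *)
Definition discrete_group (R : realType) (n : nat)
    (G : set (Rhat R (n + 1) -> Rhat R (n + 1))) :=
  exists (K : set 'rV[R]_(n + 1)) (e : R),
    [/\ compact K, K `<=` @uhs R n, 0 < e &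
        forall g, G g ->
          (forall p q, K p -> g (pt p) = pt q -> hdist p q < e) -> g = id].

Definition reflection_group (R : realType) (n : nat)
    (G : set (Rhat R (n + 1) -> Rhat R (n + 1))) :=
  (exists2 S, S `<=` @hyperbolic_reflection R n & G = gen_group S) /\
  discrete_group G.

Definition group_limit_set (R : realType) (n : nat)
    (G : set (Rhat R (n + 1) -> Rhat R (n + 1))) : set (Rhat R n) :=
  [set z | exists (p : 'rV[R]_(n + 1)) (g : nat -> Rhat R (n + 1) -> Rhat R (n + 1)),
     [/\ uhs p, forall k, G (g k) &
         (fun k => g k (pt p)) @ \oo --> ideal z]].

(* For y != z, [geodesic y z] maps ]0, +oo[ bijectively and monotonically to the
   geodesic line from y to z: a semicircle orthogonal to the boundary, or a
   vertical half-line. The case y = z = infty is irrelevant. *)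
Definition geodesic (R : realType) (n : nat) (y z : Rhat R n) (t : R) :
    'rV[R]_(n + 1) :=
  match y, z with
  | Some a, Some b =>
      (1 + t ^+ 2)^-1 *: row_mx (a + t ^+ 2 *: b) (t * enorm (b - a))%:M
  | Some a, None => row_mx a t%:M
  | None, Some b => row_mx b t^-1%:M
  | None, None => 0
  end.

Definition hconvex (R : realType) (n : nat) (C : set 'rV[R]_(n + 1)) :=
  forall (y z : Rhat R n) (t1 t2 t3 : R), y <> z ->
    0 < t1 -> t1 <= t2 -> t2 <= t3 ->
    C (geodesic y z t1) -> C (geodesic y z t3) -> C (geodesic y z t2).

(* The convex hull in hyperbolic space of a set L of ideal points. *)
Definition hull (R : realType) (n : nat) (L : set (Rhat R n)) :
    set 'rV[R]_(n + 1) :=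
  smallest (@hconvex R n)
    [set p | exists (y z : Rhat R n) (t : R),
       [/\ L y, L z, y <> z, 0 < t & p = geodesic y z t]].

Definition thickening (R : realType) (n : nat) (e : R)
    (A : set 'rV[R]_(n + 1)) : set 'rV[R]_(n + 1) :=
  [set p | uhs p /\ exists2 q, A q & hdist p q < e].

Definition box (R : realType) (m : nat) (p q : 'rV[R]_m) : set 'rV[R]_m :=
  [set x | forall i, p 0 i <= x 0 i <= q 0 i].

(* The integral over [box p q] of the hyperbolic volume density t ^- n.+1, where
   t is the height; it is meant for 0 < n, p in uhs and p <= q coordinatewise. *)
Definition box_volume (R : realType) (n : nat) (p q : 'rV[R]_(n + 1)) : R :=
  \prod_(i < n) (q 0 (lshift 1 i) - p 0 (lshift 1 i)) *
  ((height p ^- n - height q ^- n) / n%:R).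

(* Hyperbolic volume, as an outer measure. *)
Definition hvolume (R : realType) (n : nat) (A : set 'rV[R]_(n + 1)) : \bar R :=
  ereal_inf [set v | exists p q : nat -> 'rV[R]_(n + 1),
    [/\ forall k, uhs (p k),
        forall k i, p k 0 i <= q k 0 i,
        A `<=` \bigcup_k box (p k) (q k) &
        v = (\sum_(0 <= k <oo) (box_volume (p k) (q k))%:E)%E]].

(* The volume of the image of A in the quotient of hyperbolic space by G: the
   least volume of a set whose G-translates cover A. For a discrete group G and
   a G-invariant measurable set A it is the volume of the intersection of A with
   a measurable fundamental domain. *)
Definition quotient_volume (R : realType) (n : nat)
    (G : set (Rhat R (n + 1) -> Rhat R (n + 1)))
    (A : set 'rV[R]_(n + 1)) : \bar R :=
  ereal_inf [set hvolume F | F in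
    [set F : set 'rV[R]_(n + 1) | F `<=` @uhs R n /\
       @pt R (n + 1) @` A `<=` \bigcup_(g in G) g @` (@pt R (n + 1) @` F)]].

(* The convex core of G is the quotient by G of the hull of its limit set. *)
Definition geometrically_finite (R : realType) (n : nat)
    (G : set (Rhat R (n + 1) -> Rhat R (n + 1))) :=
  exists2 e : R, 0 < e &
    (quotient_volume G (thickening e (hull (group_limit_set G))) < +oo)%E.

Definition crystallographic (R : realType) (n : nat)
    (P : set (oriented R n)) :=
  exists G, [/\ reflection_group G, geometrically_finite G &
                packing_limit_set P = group_limit_set G].

Definition oriented_image (R : realType) (n : nat) (f : Rhat R n -> Rhat R n)
    (D : oriented R n) : oriented R n := (f @` carrier D, f @` inside D).

(* Collections of oriented spheres of arbitrary dimension. *)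
Definition collection (R : realType) : Type := {n : nat & set (oriented R n)}.

Definition conformally_equivalent (R : realType) (P Q : collection R) :=
  exists (n : nat) (A B : set (oriented R n)),
    [/\ P = existT _ n A, Q = existT _ n B &
        exists2 f, @moebius R n f & B = @oriented_image R n f @` A].

(* Main.v *)
(* All the packings live in dimension 2 and are indexed by N >= 1. Color the walls of
   a right-angled ideal polyhedron of hyperbolic 3-space with two colors, so that
   adjacent walls have different colors. The reflections in the walls of the first
   color ("mirrors") generate a free product of groups of order 2, by ping-pong, and
   the orbit of the walls of the second color ("base") under this group is a packing
   with the same limit set as the group: the polyhedron is a fundamental domain of
   the convex hull. We take the polyhedron over the rectangle [0, 2] x [-1, 2N - 1]
   bounded by the unit hemispheres centered at the integral points of even coordinate
   sum; the sides and the spheres centered on x = 1 are the mirrors. For N = 1 this is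
   the Apollonian strip packing. Everything is integral in the Lorentz model of the
   space of spheres.
   The packings are told apart by the strips between two tangent spheres sent to
   parallel lines: the ratio of the width of the strip to the largest radius in it is
   2N for the lines y = -1 and y = 2N - 1, and at most 2N for the other tangent pairs. *)
From HB Require Import structures.
Require Import Defs.
From mathcomp Require Import all_boot all_order all_algebra.
From mathcomp Require Import all_classical all_reals all_analysis.
From mathcomp Require Import ring lra.
Import Order.TTheory GRing.Theory Num.Theory.
Import numFieldNormedType.Exports.

Set Implicit Arguments.
Unset Strict Implicit.
Unset Printing Implicit Defensive.

(** Ping-pong is run on Lorentz products instead of regions of space: two distinct mirrors have
    product at most -1, a mirror and a base wall have product 0 or at most -2, and products with a
    base wall can only decrease along reduced words. The gap between -1 and -2 prevents a sphere
    from being tangent to its own translates; tangent pairs are then translates of pairs of base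
    walls, and the invariant becomes a finite check. Spheres, boundary points and points of
    hyperbolic space live in one vector space, and the sign of a product decides on which side of a
    sphere a point lies. For two tangent spheres [v] and [w] the sum [v + w] is lightlike, and its
    product with a third sphere is minus the ratio of width to radius, so the invariant is computed
    without sending the pair to parallel lines. Limit sets are handled by estimates uniform in the
    bend: the function cutting out a sphere has a gradient of norm 1 along that sphere. *)

Local Open Scope classical_set_scope.
Local Open Scope ring_scope.

(* The sphere of bend [b] and center [c] is the vector [(b, b', b c)] of Lorentz
   norm 1, and the half-plane [u . x > d], [u] of norm 1, is [(0, 2 d, u)]. *)
Record lvec (R : Type) := LVec { bend : R; cobend : R; lx : R; ly : R }.
HB.instance Definition _ (R : Type) := gen_eqMixin (lvec R).

(** * The Lorentz form of signature (3, 1) and words in its reflections *)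

Section Lorentz.
Context {R : realType}.
Implicit Types a u v w : lvec R.

Definition ladd u v : lvec R :=
  LVec (bend u + bend v) (cobend u + cobend v) (lx u + lx v) (ly u + ly v).
Definition lscale (k : R) v : lvec R :=
  LVec (k * bend v) (k * cobend v) (k * lx v) (k * ly v).
Definition ldot u v : R :=
  lx u * lx v + ly u * ly v - (bend u * cobend v + cobend u * bend v) / 2.
Definition lrefl a v : lvec R := ladd v (lscale (- (2 * ldot a v)) a).

Lemma lvec_eq u v : bend u = bend v -> cobend u = cobend v ->
  lx u = lx v -> ly u = ly v -> u = v.
Proof. by case: u v => ? ? ? ? [? ? ? ?] /= -> -> -> ->. Qed.

Lemma ldotC u v : ldot u v = ldot v u.
Proof. rewrite /ldot; ring. Qed.
Lemma ldotDl u v w : ldot (ladd u v) w = ldot u w + ldot v w.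
Proof. rewrite /ldot /=; ring. Qed.
Lemma ldotDr u v w : ldot w (ladd u v) = ldot w u + ldot w v.
Proof. rewrite /ldot /=; ring. Qed.
Lemma ldotZl k u w : ldot (lscale k u) w = k * ldot u w.
Proof. rewrite /ldot /=; ring. Qed.
Lemma ldotZr k u w : ldot w (lscale k u) = k * ldot w u.
Proof. rewrite /ldot /=; ring. Qed.

Lemma ldot_lrefl a u v : ldot u (lrefl a v) = ldot u v - 2 * ldot a v * ldot u a.
Proof. by rewrite ldotDr ldotZr; ring. Qed.

Lemma lrefl_sym a u v : ldot (lrefl a u) v = ldot u (lrefl a v).
Proof. by rewrite ldotC !ldot_lrefl (ldotC v u) (ldotC v a) (ldotC u a); ring. Qed.

Lemma lreflK a v : ldot a a = 1 -> lrefl a (lrefl a v) = v.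
Proof.
move=> a1; rewrite {1}/lrefl ldot_lrefl a1.
by apply: lvec_eq => /=; ring.
Qed.

Lemma lrefl_isom a u v : ldot a a = 1 -> ldot (lrefl a u) (lrefl a v) = ldot u v.
Proof. by move=> a1; rewrite lrefl_sym lreflK. Qed.

Lemma lrefl_orth a v : ldot a v = 0 -> lrefl a v = v.
Proof. by move=> h; rewrite /lrefl h; apply: lvec_eq => /=; ring. Qed.

Lemma lreflD a u v : lrefl a (ladd u v) = ladd (lrefl a u) (lrefl a v).
Proof. by rewrite /lrefl ldotDr; apply: lvec_eq => /=; ring. Qed.
Lemma lreflZ a k v : lrefl a (lscale k v) = lscale k (lrefl a v).
Proof. by rewrite /lrefl ldotZr; apply: lvec_eq => /=; ring. Qed.

Definition lact (l : seq (lvec R)) v : lvec R := foldr lrefl v l.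

Lemma lactD l u v : lact l (ladd u v) = ladd (lact l u) (lact l v).
Proof. by elim: l => //= a l ->; rewrite lreflD. Qed.
Lemma lactZ l k v : lact l (lscale k v) = lscale k (lact l v).
Proof. by elim: l => //= a l ->; rewrite lreflZ. Qed.

Lemma lact_cat l1 l2 v : lact (l1 ++ l2) v = lact l1 (lact l2 v).
Proof. by rewrite /lact foldr_cat. Qed.

Lemma lact_sym l u v : ldot (lact l u) v = ldot u (lact (rev l) v).
Proof.
elim: l u v => // a l IH u v.
by rewrite rev_cons -cats1 lact_cat -IH /= lrefl_sym.
Qed.

Lemma lact_isom l u v : (forall a, a \in l -> ldot a a = 1) ->
  ldot (lact l u) (lact l v) = ldot u v.
Proof.
elim: l => //= a l IH h.
by rewrite lrefl_isom ?IH // => [b hb|]; apply: h; rewrite inE ?hb ?orbT ?eqxx.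
Qed.

Lemma lactK l v : (forall a, a \in l -> ldot a a = 1) ->
  lact (rev l) (lact l v) = v.
Proof.
elim: l => //= a l IH h.
by rewrite rev_cons -cats1 lact_cat /= lreflK ?IH // => [b hb|]; apply: h;
  rewrite inE ?hb ?orbT ?eqxx.
Qed.

Lemma lactKr l v : (forall a, a \in l -> ldot a a = 1) ->
  lact l (lact (rev l) v) = v.
Proof.
by move=> h; rewrite -{1}(revK l) lactK // => a; rewrite mem_rev; apply: h.
Qed.

End Lorentz.

(** * Linear ping-pong and the orbit of the base walls *)

Section PingPong.
Context {R : realType} (A : set (lvec R)).
Implicit Types a u v w x : lvec R.
Hypothesis A1 : forall a, A a -> ldot a a = 1.
Hypothesis AA : forall a a', A a -> A a' -> a <> a' -> ldot a a' <= -1.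

(* The form of reducedness of the word [l] that makes ping-pong work. *)
Fixpoint good x (l : seq (lvec R)) : Prop :=
  if l is a :: l' then [/\ A a, good x l' & ldot a (lact l' x) < 0] else True.

(** The closed fundamental chamber. It is used for base walls, which are spacelike, as well as for
    points of hyperbolic space, which are timelike. *)
Definition dominated x := forall a, A a -> ldot a x <= 0.

(** A sign alone would not survive the induction. For the previous letter [a1], where the product is
    positive, the next step needs [ldot a1 v <= - ldot a v], which is the quantitative bound at [a];
    the other mirrors already have negative products. *)
Lemma good_head x a l : dominated x -> good x (a :: l) ->
  0 < ldot a (lact (a :: l) x) /\
  forall a', A a' -> a' <> a -> ldot a' (lact (a :: l) x) <= - ldot a (lact (a :: l) x).
Proof.
move=> dx; elim: l a => [|a1 l IH] a /= [Aa gl neg].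
  rewrite !ldot_lrefl (A1 Aa); split; first by lra.
  move=> a' Aa' ne; rewrite !ldot_lrefl.
  have d := dx _ Aa'; have h := AA Aa' Aa ne.
  have : 0 <= (- ldot a x) * (-1 - ldot a' a) by apply: mulr_ge0; lra.
  lra.
have Aa1 : A a1 by case: gl.
have := IH a1 gl; move: neg; rewrite [lact (a1 :: l) x]/=.
move: (lrefl a1 (lact l x)) => v neg [pos dom].
have ne1 : a <> a1 by move=> e; move: neg pos; rewrite e; lra.
have da := dom _ Aa ne1.
rewrite !ldot_lrefl (A1 Aa); split; first by lra.
move=> a' Aa' ne; rewrite !ldot_lrefl.
have h := AA Aa' Aa ne.
have : ldot a' v <= - ldot a v.
  have [->|] := pselect (a' = a1); first by lra.
  by move=> /(dom _ Aa'); lra.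
have : 0 <= (- ldot a v) * (-1 - ldot a' a) by apply: mulr_ge0; lra.
lra.
Qed.

(** A new letter on the left is kept if its product is negative and dropped if it is zero, since the
    vector is then fixed. If it is positive, [good_head] identifies it with the first letter of the
    word, and the two cancel. *)
Lemma good_reduce x l : dominated x -> (forall a, a \in l -> A a) ->
  exists2 l', good x l' & lact l x = lact l' x.
Proof.
move=> dx; elim: l => [|a l IH] Al; first by exists [::].
have [|l' gl' e] := IH; first by move=> b hb; apply: Al; rewrite inE hb orbT.
have Aa : A a by apply: Al; rewrite inE eqxx.
rewrite /= e; case: (ltrgt0P (ldot a (lact l' x))) => [pos|neg|z].
- case: l' gl' pos {e} => [_ /=|a1 l' gl' pos]; first by have := dx _ Aa; lra.
  have [p dom] := good_head dx gl'.
  have [e|ne] := pselect (a = a1).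
    exists l'; first by case: gl'.
    by rewrite e /= lreflK //; apply: A1; case: gl'.
  by have := dom _ Aa ne; lra.
- by exists (a :: l').
- by exists l'; rewrite ?lrefl_orth.
Qed.

(** For strictly dominated vectors the product with a new letter never vanishes, so words are
    reduced by cancelling equal neighbours only. The composite of any involutions [F a] is then
    unchanged, which gives equality of maps and not merely of images of [x]. *)
Lemma good_reduce_strict (T : Type) (F : lvec R -> T -> T) x l :
  (forall a, A a -> involutive (F a)) -> (forall a, A a -> ldot a x < 0) ->
  (forall a, a \in l -> A a) -> exists2 l', good x l' &
    foldr (fun a f => F a \o f) id l = foldr (fun a f => F a \o f) id l'.
Proof.
move=> FK sx; have dx : dominated x by move=> a /sx/ltW.
elim: l => [|a l IH] Al; first by exists [::].
have [|l' gl' e] := IH; first by move=> b hb; apply: Al; rewrite inE hb orbT.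
have Aa : A a by apply: Al; rewrite inE eqxx.
rewrite /= e; case: l' gl' {e} => [_|a1 l' gl'].
  by exists [:: a] => //=; split=> //; apply: sx.
have [p dom] := good_head dx gl'.
have [->|ne] := pselect (a = a1).
  exists l'; first by case: gl'.
  by apply/funext => y /=; rewrite FK //; case: gl'.
exists [:: a, a1 & l'] => //; split=> //.
by apply: le_lt_trans (dom _ Aa ne) _; rewrite oppr_lt0.
Qed.

Lemma good_in x l a : good x l -> a \in l -> A a.
Proof. by elim: l => //= b l IH [Ab /IH g _]; rewrite inE => /predU1P[->|]. Qed.

(* Along a good word the product with a dominated vector cannot increase: this makes
   the orbit of the base spheres a packing. *)
Lemma good_noninc x l y : dominated y -> good x l -> ldot y (lact l x) <= ldot y x.
Proof.
move=> dy; elim: l => [|a l IH] //= [Aa gl neg].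
have := IH gl; rewrite ldot_lrefl; have := dy _ Aa; rewrite (ldotC a y); move: neg; nra.
Qed.

(** Each letter [a] lowers the product by twice the product of a negative number and of the
    nonpositive [ldot y a]. No drop in total forces every [ldot y a] to vanish. *)
Lemma good_fix x l y : dominated y -> good x l ->
  ldot y (lact l x) = ldot y x -> forall a, a \in l -> ldot a y = 0.
Proof.
move=> dy; elim: l => [|a l IH] //= [Aa gl neg]; rewrite ldot_lrefl => e.
have h := good_noninc dy gl; have d := dy _ Aa; rewrite (ldotC a y) in d.
have z : ldot y a = 0 by move: neg d h e; nra.
move=> b; rewrite inE => /predU1P[->|]; first by rewrite ldotC.
by apply: IH => //; rewrite -e z; ring.
Qed.

Lemma lact_fixed l y : (forall a, a \in l -> ldot a y = 0) -> lact l y = y.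
Proof.
elim: l => //= a l IH h; rewrite IH => [|b hb]; last by apply: h; rewrite inE hb orbT.
by apply: lrefl_orth; apply: h; rewrite inE eqxx.
Qed.

Variable B : set (lvec R).
Hypothesis B1 : forall b, B b -> ldot b b = 1.
Hypothesis BB : forall b b', B b -> B b' -> b <> b' -> ldot b b' <= -1.
Hypothesis AB : forall a b, A a -> B b -> ldot a b = 0 \/ ldot a b <= -2.

Lemma B_dominated b : B b -> dominated b.
Proof. by move=> Bb a Aa; have [->|] := AB Aa Bb; lra. Qed.

(** Distinct base walls start at product at most -1 and can only go down. For a wall and its own
    translate the product starts at 1, and the first letter not orthogonal to [b] brings it to at
    most 1 - 2 * 2^2 = -7, hence strictly beyond tangency. *)
Lemma good_orbit l b b' : B b -> B b' -> good b l -> lact l b <> b' ->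
  ldot b' (lact l b) <= -1 /\ (ldot b' (lact l b) = -1 -> lact l b' = b').
Proof.
move=> Bb Bb' gl ne.
have [e|nb] := pselect (b' = b); last first.
  have h := BB Bb' Bb nb; have h' := good_noninc (B_dominated Bb') gl.
  split=> [|e]; first by lra.
  by apply: lact_fixed; apply: good_fix gl _ => //; [exact: B_dominated|lra].
subst b'.
suff h : lact l b = b \/ ldot b (lact l b) <= -7.
  case: h => [//|h]; split=> [|e]; first by lra.
  by move: h; rewrite e lerN2 (ler_nat _ 7 1).
elim: l gl {ne} => [|a l IH] /=; first by left.
move=> [Aa gl neg]; right.
have [e|h] := IH gl; last first.
  rewrite ldot_lrefl; have := B_dominated Bb Aa; rewrite (ldotC a b).
  by move: neg h; nra.
rewrite e in neg *; rewrite ldot_lrefl B1 // (ldotC b a).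
by have [|] := AB Aa Bb; [lra|nra].
Qed.

Definition orbit : set (lvec R) :=
  [set v | exists (l : seq (lvec R)) b, [/\ forall a, a \in l -> A a, B b & v = lact l b]].

Lemma word_unit (l : seq (lvec R)) : (forall a, a \in l -> A a) -> forall a, a \in l -> ldot a a = 1.
Proof. by move=> h a /h/A1. Qed.

Lemma orbit_unit v : orbit v -> ldot v v = 1.
Proof. by case=> l [b [Al Bb ->]]; rewrite lact_isom ?B1 //; apply: word_unit. Qed.

Lemma orbit_lact l v : (forall a, a \in l -> A a) -> orbit v -> orbit (lact l v).
Proof.
move=> Al [l' [b [Al' Bb ->]]]; exists (l ++ l'), b; split; rewrite ?lact_cat //.
by move=> a; rewrite mem_cat => /orP[/Al|/Al'].
Qed.

Lemma orbit_base b : B b -> orbit b.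
Proof. by move=> Bb; exists [::], b. Qed.

Lemma orbit_dot v w : orbit v -> orbit w -> v <> w -> ldot v w <= -1.
Proof.
move=> [l [b [Al Bb ->]]] [l' [b' [Al' Bb' ->]]] ne.
have u := word_unit Al.
have [l1 gl1 e] : exists2 l1, good b' l1 & lact (rev l ++ l') b' = lact l1 b'.
  apply: good_reduce; first exact: B_dominated.
  by move=> a; rewrite mem_cat mem_rev => /orP[/Al|/Al'].
rewrite lact_sym -lact_cat e.
case: (@good_orbit l1 b' b) => // e1; apply: ne.
by rewrite -e1 -e lact_cat lactKr.
Qed.

(** In case of tangency the reduced word that relates the two spheres fixes the other base wall, so
    appending it to [l] yields one word for both spheres. *)
Lemma orbit_tangent v w : orbit v -> orbit w -> ldot v w = -1 ->
  exists (l : seq (lvec R)) b b', [/\ forall a, a \in l -> A a, B b, B b', v = lact l b & w = lact l b'].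
Proof.
move=> [l [b [Al Bb ->]]] [l' [b' [Al' Bb' ->]]].
have u := word_unit Al.
have [l1 gl1 e] : exists2 l1, good b' l1 & lact (rev l ++ l') b' = lact l1 b'.
  apply: good_reduce; first exact: B_dominated.
  by move=> a; rewrite mem_cat mem_rev => /orP[/Al|/Al'].
rewrite lact_sym -lact_cat e => d.
have [|_ /(_ d) fb] := good_orbit Bb' Bb gl1.
  by move=> eb; have := ltrN10 R; rewrite -d eb B1 // ltr10.
exists (l ++ l1), b, b'; split => //.
- by move=> a; rewrite mem_cat => /orP[/Al|/(good_in gl1)].
- by rewrite lact_cat fb.
- by rewrite lact_cat -e lact_cat lactKr.
Qed.

End PingPong.

(** * Euclidean inner products and the involutivity of reflections *)

Section Inversions.
Context {R : realType} {m : nat}.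
Implicit Types x y a u : 'rV[R]_m.

Lemma dot_ge0 x : 0 <= dot x x.
Proof. by apply: sumr_ge0 => i _; rewrite -expr2 sqr_ge0. Qed.

Lemma enorm_sqr x : enorm x ^+ 2 = dot x x.
Proof. by rewrite sqr_sqrtr // dot_ge0. Qed.

Lemma enorm_ge0 x : 0 <= enorm x.
Proof. exact: sqrtr_ge0. Qed.

Lemma dotZl k x y : dot (k *: x) y = k * dot x y.
Proof. by rewrite /dot mulr_sumr; apply: eq_bigr => i _; rewrite mxE mulrA. Qed.
Lemma dotZr k x y : dot x (k *: y) = k * dot x y.
Proof. by rewrite /dot mulr_sumr; apply: eq_bigr => i _; rewrite mxE mulrCA. Qed.
Lemma dotBr x y z : dot x (y - z) = dot x y - dot x z.
Proof. by rewrite /dot -sumrB; apply: eq_bigr => i _; rewrite !mxE mulrBr. Qed.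

Lemma dot_eq0 x : (dot x x == 0) = (x == 0).
Proof.
apply/eqP/eqP => [h|->]; last by rewrite /dot big1 // => i _; rewrite mxE mul0r.
apply/rowP => i; rewrite mxE; apply/eqP; rewrite -sqrf_eq0 expr2; apply/eqP.
by apply: (psumr_eq0P _ h) => // j _; rewrite -expr2 sqr_ge0.
Qed.

Lemma dot_gt0 x : x != 0 -> 0 < dot x x.
Proof. by move=> x0; rewrite lt_neqAle dot_ge0 andbT eq_sym dot_eq0. Qed.

Lemma sphere_inversion_pt a r x : x != a ->
  sphere_inversion a r (pt x) = pt (a + (r ^+ 2 / dot (x - a) (x - a)) *: (x - a)).
Proof. by move=> /negPf xa; rewrite /sphere_inversion /= xa enorm_sqr. Qed.

Lemma sphere_inversionK a r : 0 < r -> involutive (sphere_inversion a r).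
Proof.
move=> r0 [x|]; last by rewrite /= eqxx.
have [->|xa] := eqVneq x a; first by rewrite /= eqxx.
rewrite -/(pt x) sphere_inversion_pt //; set k := r ^+ 2 / _.
have d0 : 0 < dot (x - a) (x - a) by rewrite dot_gt0 // subr_eq0.
have k0 : 0 < k by rewrite divr_gt0 // exprn_gt0.
have e : a + k *: (x - a) - a = k *: (x - a) by rewrite addrAC subrr add0r.
rewrite sphere_inversion_pt; last first.
  by rewrite -subr_eq0 e scaler_eq0 negb_or gt_eqF //= subr_eq0.
rewrite e dotZl dotZr scalerA; congr (pt _).
rewrite (_ : _ * k = 1) ?scale1r; first by rewrite addrC subrK.
by rewrite /k; field; rewrite !gt_eqF.
Qed.

Lemma plane_reflectionK u c : u != 0 -> involutive (plane_reflection u c).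
Proof.
move=> u0 [x|] //; rewrite /plane_reflection /= enorm_sqr; congr (pt _).
rewrite dotBr dotZr -addrA -opprD -scalerDl (_ : 2 * _ / _ + _ = 0) ?scale0r ?subr0 //.
by field; rewrite gt_eqF // dot_gt0.
Qed.

End Inversions.

(** * Lifting boundary points and reflections to Lorentz space *)

Section Lifts.
Context {R : realType}.

Definition row2 (a b : R) : 'rV[R]_2 := \row_i (if i == 0 then a else b).

Lemma row2E0 a b : row2 a b 0 0 = a. Proof. by rewrite mxE. Qed.
Lemma row2E1 a b : row2 a b 0 1 = b. Proof. by rewrite mxE. Qed.

Lemma row2P (x y : 'rV[R]_2) : x 0 0 = y 0 0 -> x 0 1 = y 0 1 -> x = y.
Proof.
move=> e0 e1; apply/rowP => -[[|[|//]] i].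
  by rewrite (_ : Ordinal i = 0) //; apply: val_inj.
by rewrite (_ : Ordinal i = 1) //; apply: val_inj.
Qed.

Lemma dot2 (x y : 'rV[R]_2) : dot x y = x 0 0 * y 0 0 + x 0 1 * y 0 1.
Proof.
rewrite /dot big_ord_recl big_ord1; congr (_ + _ * _); congr (_ 0 _); exact: val_inj.
Qed.

Lemma dot3 (p q : 'rV[R]_(2 + 1)) : dot p q = p 0 (lshift 1 0) * q 0 (lshift 1 0) +
  p 0 (lshift 1 1) * q 0 (lshift 1 1) + height p * height q.
Proof.
rewrite /dot big_split_ord /= big_ord1 big_ord_recl big_ord1 /height.
by congr (_ + _ * _ + _); congr (_ 0 _); apply: val_inj.
Qed.

(* The point of the light cone above a boundary point. *)
Definition blift (z : Rhat R 2) : lvec R :=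
  if z is Some x then LVec 1 (x 0 0 ^+ 2 + x 0 1 ^+ 2) (x 0 0) (x 0 1)
  else LVec 0 1 0 0.

(* The point of the hyperboloid [ldot v v = -1] above a point of the upper
   half-space. *)
Definition hyp (p : 'rV[R]_(2 + 1)) : lvec R :=
  lscale (height p)^-1
    (LVec 1 (p 0 (lshift 1 0) ^+ 2 + p 0 (lshift 1 1) ^+ 2 + height p ^+ 2)
       (p 0 (lshift 1 0)) (p 0 (lshift 1 1))).

(** The second coordinate is the signed bend of the image under inversion in the unit circle, for
    spheres and for planes alike. *)
Definition sphere_lvec (a : 'rV[R]_2) (r : R) : lvec R :=
  LVec r^-1 ((dot a a - r ^+ 2) / r) (a 0 0 / r) (a 0 1 / r).
Definition plane_lvec (u : 'rV[R]_2) (c : R) : lvec R :=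
  LVec 0 (2 * c / enorm u) (u 0 0 / enorm u) (u 0 1 / enorm u).

Lemma sphere_lvec_unit a r : 0 < r -> ldot (sphere_lvec a r) (sphere_lvec a r) = 1.
Proof. by move=> r0; rewrite /ldot /= dot2; field; rewrite gt_eqF. Qed.

Lemma enorm_gt0 (u : 'rV[R]_2) : u != 0 -> 0 < enorm u.
Proof. by move=> u0; rewrite sqrtr_gt0 dot_gt0. Qed.

Lemma plane_lvec_unit u c : u != 0 -> ldot (plane_lvec u c) (plane_lvec u c) = 1.
Proof.
move=> u0; rewrite /ldot /= !mul0r mulr0 addr0 mul0r subr0.
rewrite -!expr2 !expr_div_n -mulrDl enorm_sqr dot2 -!expr2 divff //.
by rewrite !expr2 -dot2 gt_eqF // dot_gt0.
Qed.

(** Away from the center, the factor is the reciprocal of the conformal factor of the inversion. Its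
    positivity is what preserves sides of spheres. *)
Lemma blift_sphere_inversion a r z : 0 < r -> exists2 k, 0 < k &
  lrefl (sphere_lvec a r) (blift z) = lscale k (blift (sphere_inversion a r z)).
Proof.
move=> r0; case: z => [x|]; last first.
  exists (r ^- 2); first by rewrite invr_gt0 exprn_gt0.
  by apply: lvec_eq; rewrite /lrefl /ldot /= ?dot2; field; rewrite gt_eqF.
have [->|xa] := eqVneq x a.
  exists (r ^+ 2); first by rewrite exprn_gt0.
  by apply: lvec_eq; rewrite /lrefl /ldot /= eqxx /= ?dot2; field; rewrite gt_eqF.
have d0 : 0 < dot (x - a) (x - a) by rewrite dot_gt0 // subr_eq0.
exists (dot (x - a) (x - a) / r ^+ 2); first by rewrite divr_gt0 // exprn_gt0.
rewrite -/(pt x) sphere_inversion_pt //; move: d0.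
rewrite !dot2 !mxE => d0.
by apply: lvec_eq; rewrite /lrefl /ldot /= ?dot2 ?mxE; field; rewrite ?gt_eqF.
Qed.

Lemma blift_plane_reflection u c z : u != 0 ->
  lrefl (plane_lvec u c) (blift z) = blift (plane_reflection u c z).
Proof.
move=> u0; have n0 := enorm_gt0 u0; have := enorm_sqr u; rewrite dot2 => nE.
case: z => [x|]; last by apply: lvec_eq; rewrite /lrefl /ldot /=; field; rewrite gt_eqF.
by apply: lvec_eq; rewrite /lrefl /ldot /= ?mxE ?dot2; field: nE; rewrite ?gt_eqF.
Qed.

End Lifts.

(** * Oriented circles as unit vectors, and the Lorentz lift of Moebius maps *)

Section Spheres.
Context {R : realType}.
Implicit Types u v w : lvec R.

Definition lsphere v : oriented R 2 :=
  ([set z | ldot v (blift z) = 0], [set z | 0 < ldot v (blift z)]).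

Definition lcenter v : 'rV[R]_2 := row2 (lx v / bend v) (ly v / bend v).

Lemma lsphere_inside_nonempty v : ldot v v = 1 -> exists z, 0 < ldot v (blift z).
Proof.
rewrite /ldot => v1; case: (ltrgt0P (bend v)) => [b|b|b].
- exists (pt (lcenter v)); rewrite /= !mxE /=.
  have -> : lx v * (lx v / bend v) + ly v * (ly v / bend v) -
     (bend v * ((lx v / bend v) ^+ 2 + (ly v / bend v) ^+ 2) + cobend v * 1) / 2 =
     (lx v * lx v + ly v * ly v - (bend v * cobend v + cobend v * bend v) / 2) / (2 * bend v).
    by field; rewrite gt_eqF.
  by rewrite v1 divr_gt0 // mulr_gt0.
- by exists infty => /=; lra.
(* The point at depth 1 in the half-plane, on the normal line through the origin. *)
- exists (pt (row2 ((cobend v / 2 + 1) * lx v) ((cobend v / 2 + 1) * ly v))).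
  rewrite /= !mxE /= b; move: v1; rewrite b => v1.
  suff : 0 < (lx v * lx v + ly v * ly v) * (cobend v / 2 + 1) - cobend v / 2 by lra.
  by rewrite (_ : lx v * lx v + ly v * ly v = 1); lra.
Qed.

(** A few points of the carrier determine the vector up to a scalar: infinity and two points for a
    line, the four axis points for a circle. Unit norm leaves a sign, which a point of the interior
    settles. *)
Lemma lsphere_inj v w : ldot v v = 1 -> ldot w w = 1 -> lsphere v = lsphere w -> v = w.
Proof.
move=> v1 w1 [eC eI].
have C z : ldot v (blift z) = 0 -> ldot w (blift z) = 0.
  by move=> h; have : [set z | ldot v (blift z) = 0] z by []; rewrite eC.
have [k wk] : exists k, w = lscale k v.
  have [b0|b0] := eqVneq (bend v) 0.
    have bw : bend w = 0.
      have := C infty; rewrite /ldot /= b0 => /(_ ltac:(lra)); lra.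
    have u1 : lx v ^+ 2 = 1 - ly v ^+ 2 by rewrite -v1 /ldot b0; ring.
    have P s : ldot w (blift (pt (row2 (cobend v / 2 * lx v - s * ly v)
        (cobend v / 2 * ly v + s * lx v)))) = 0.
      by apply: C; rewrite /ldot /= !mxE /= b0; ring: u1.
    have := P 0; have := P 1; rewrite /ldot /= !mxE /= bw => e1 e2.
    have e3 : ly w * lx v = lx w * ly v by lra.
    exists (lx w * lx v + ly w * ly v).
    apply: lvec_eq; rewrite /= ?b0 ?bw ?mulr0 //; last 2 first.
    - have -> : (lx w * lx v + ly w * ly v) * lx v =
        lx w * lx v ^+ 2 + ly w * lx v * ly v by ring.
      by rewrite u1 e3; ring.
    - have -> : (lx w * lx v + ly w * ly v) * ly v =
        lx w * ly v * lx v + ly w * ly v ^+ 2 by ring.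
      by rewrite -e3 -mulrA -expr2 u1; ring.
    - by lra.
  have n2 : lx v ^+ 2 = 1 + bend v * cobend v - ly v ^+ 2 by rewrite -v1 /ldot; field.
  have P s t : t ^+ 2 = 1 - s ^+ 2 ->
      2 * (lx w * (lx v + s) + ly w * (ly v + t)) * bend v =
      bend w * ((lx v + s) ^+ 2 + (ly v + t) ^+ 2) + cobend w * bend v ^+ 2.
    move=> st; have := C (pt (row2 ((lx v + s) / bend v) ((ly v + t) / bend v))).
    rewrite /ldot /= !mxE /= => /(_ ltac:(by field: n2 st)) h.
    apply/eqP; rewrite -subr_eq0; apply/eqP.
    by transitivity (2 * bend v ^+ 2 * 0); [rewrite -h; field | rewrite mulr0].
  have c0 := P 1 0 ltac:(ring); have c1 := P (-1) 0 ltac:(ring).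
  have c2 := P 0 1 ltac:(ring); have c3 := P 0 (-1) ltac:(ring).
  have ex : lx w = bend w / bend v * lx v.
    by apply: (mulIf b0); rewrite mulrAC divfK //; lra.
  have ey : ly w = bend w / bend v * ly v.
    by apply: (mulIf b0); rewrite mulrAC divfK //; lra.
  exists (bend w / bend v); apply: lvec_eq; rewrite ?ex ?ey //=; first by field.
  apply: (mulIf (expf_neq0 2 b0)); move: c0; rewrite ex ey addr0 => c0.
  apply: (addrI (bend w * ((lx v + 1) ^+ 2 + ly v ^+ 2))); rewrite -c0.
  by field: n2.
have [z vz] := lsphere_inside_nonempty v1.
have : [set z | 0 < ldot v (blift z)] z by [].
rewrite eI /= wk ldotZl pmulr_lgt0 // => k0.
have : k ^+ 2 = 1 by rewrite -w1 wk ldotZl ldotZr v1 mulr1.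
move/eqP; rewrite sqrf_eq1 => /orP[] /eqP kE; last by rewrite kE ltr0N1 in k0.
by rewrite kE; apply: lvec_eq; rewrite /= mul1r.
Qed.

Lemma ldot_center v x : bend v != 0 -> ldot v v = 1 ->
  ldot v (blift (pt x)) =
    ((bend v)^-1 ^+ 2 - enorm (x - lcenter v) ^+ 2) * (bend v / 2).
Proof.
move=> b0 v1; have n2 : lx v ^+ 2 = 1 + bend v * cobend v - ly v ^+ 2.
  by rewrite -v1 /ldot; field.
by rewrite enorm_sqr dot2 !mxE /ldot /=; field: n2.
Qed.

Lemma lsphere_has_bend v : ldot v v = 1 -> 0 <= bend v -> has_bend (lsphere v) (bend v).
Proof.
move=> v1; rewrite le_eqVlt => /predU1P[b0|b0].
  have u1 : lx v ^+ 2 + ly v ^+ 2 = 1 by rewrite -v1 /ldot -b0; ring.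
  have u0 : row2 (lx v) (ly v) != 0.
    apply/eqP => u0; move: u1; rewrite -(row2E0 (lx v) (ly v)) -{2}(row2E1 (lx v) (ly v)).
    by rewrite u0 !mxE expr0n addr0 => /esym/eqP; rewrite oner_eq0.
  rewrite -b0 (_ : lsphere v = (infty |` @pt R 2 @` [set x | dot (row2 (lx v) (ly v)) x = cobend v / 2],
              @pt R 2 @` [set x | dot (row2 (lx v) (ly v)) x > cobend v / 2])).
    exact: half_space_interior.
  congr pair; apply/seteqP; split => -[x|] /=; rewrite /ldot /= -?b0.
  - by move=> h; right; exists x => //=; rewrite dot2 !mxE /=; lra.
  - by move=> _; left.
  - by case=> // -[y /=]; rewrite dot2 !mxE /= => h [<-]; lra.
  - by move=> _; lra.
  - by move=> h; exists x => //=; rewrite dot2 !mxE /=; lra.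
  - by move=> h; exfalso; lra.
  - by case=> y /=; rewrite dot2 !mxE /= => h [<-]; lra.
  - by case.
have b1 : bend v != 0 by rewrite gt_eqF.
have r0 : 0 < (bend v)^-1 by rewrite invr_gt0.
have h0 : 0 < bend v / 2 by rewrite divr_gt0.
rewrite -[bend v]invrK (_ : lsphere v =
    (@pt R 2 @` [set x | enorm (x - lcenter v) = (bend v)^-1],
     @pt R 2 @` [set x | enorm (x - lcenter v) < (bend v)^-1])).
  exact: bounded_interior.
have E x := ldot_center x b1 v1; rewrite /= in E.
congr pair; apply/seteqP; split => -[x|] /=; rewrite ?E //.
- move/eqP; rewrite mulf_eq0 (gt_eqF h0) orbF subr_eq0 eqrXn2 ?enorm_ge0 ?ltW //.
  by move/eqP => e; exists x.
- by rewrite /ldot /=; lra.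
- by case=> y /= e [<-]; rewrite e subrr mul0r.
- by case.
- rewrite pmulr_lgt0 // subr_gt0 ltr_pXn2r ?nnegrE ?enorm_ge0 ?ltW //.
  by move=> e; exists x.
- by rewrite /ldot /= => h; exfalso; lra.
- case=> y /= e [<-].
  by rewrite pmulr_lgt0 // subr_gt0 ltr_pXn2r ?nnegrE ?enorm_ge0 ?ltW.
- by case.
Qed.

Definition lorentz_lift (f : Rhat R 2 -> Rhat R 2) (phi : lvec R -> lvec R) :=
  (forall u v, ldot (phi u) (phi v) = ldot u v) /\
  forall v z, exists2 k, 0 < k & ldot (phi v) (blift (f z)) = k * ldot v (blift z).

Lemma reflection_lorentz f : reflection f -> exists phi,
  [/\ involutive f, involutive phi & lorentz_lift f phi].
Proof.
case=> [[a [r [r0 ->]]]|[u [c [u0 ->]]]].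
  have a1 := sphere_lvec_unit a r0.
  exists (lrefl (sphere_lvec a r)); split.
  - exact: sphere_inversionK.
  - by move=> v; apply: lreflK.
  - split=> [v w|v z]; first exact: lrefl_isom.
    have [k k0 e] := blift_sphere_inversion a z r0.
    exists k^-1; first by rewrite invr_gt0.
    apply: (mulfI (lt0r_neq0 k0)); rewrite mulrA divff ?gt_eqF // mul1r.
    by rewrite -ldotZr -e lrefl_isom.
have u1 := plane_lvec_unit c u0.
exists (lrefl (plane_lvec u c)); split.
- exact: plane_reflectionK.
- by move=> v; apply: lreflK.
- split=> [v w|v z]; first exact: lrefl_isom.
  by exists 1 => //; rewrite -blift_plane_reflection // lrefl_isom // mul1r.
Qed.

(** Inverses of both [f] and [phi] are carried along because [gen_group_inv] inverts only the map of
    the boundary, and its lift has to be inverted with it. *)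
Lemma moebius_lorentz f : moebius f -> exists g phi psi,
  [/\ cancel f g, cancel g f, cancel phi psi, cancel psi phi & lorentz_lift f phi].
Proof.
elim=> {f} [|f /reflection_lorentz[phi [fK pK pf]]||].
- exists id, id, id; split => //; split=> // v z; exists 1 => //=; by rewrite mul1r.
- by exists f, phi, phi; split.
- move=> f g _ [f' [phi [phi' [fK f'K pK p'K [pi pl]]]]] _ [g' [psi [psi' [gK g'K qK q'K [qi ql]]]]].
  exists (g' \o f'), (phi \o psi), (psi' \o phi'); split; try exact: can_comp.
  split=> [u v|v z] /=; first by rewrite pi qi.
  have [k k0 e] := ql v z; have [k' k0' e'] := pl (psi v) (g z).
  by exists (k' * k); rewrite ?mulr_gt0 // e' e mulrA.
- move=> f g _ [f' [phi [psi [fK f'K pK p'K [pi pl]]]]] fg gf.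
  exists f, psi, phi; split=> //; split=> [u v|v z]; first by rewrite -pi !p'K.
  have [k k0] := pl (psi v) (g z); rewrite p'K gf => e.
  by exists k^-1; rewrite ?invr_gt0 // e mulKf ?gt_eqF.
Qed.

Lemma moebius_lsphere f : moebius f -> exists2 phi : lvec R -> lvec R,
  (forall u v, ldot (phi u) (phi v) = ldot u v) &
  forall v, oriented_image f (lsphere v) = lsphere (phi v).
Proof.
move=> /moebius_lorentz[g [phi [_ [fK gK _ _ [pi pl]]]]]; exists phi => // v.
congr pair; apply/seteqP; split=> [_ /= [z vz <-]|z /=].
- by have [k k0 ->] := pl v z; rewrite vz mulr0.
- have [k k0] := pl v (g z); rewrite gK => -> /eqP; rewrite mulf_eq0 gt_eqF //= => /eqP h.
  by exists (g z).
- by have [k k0 ->] := pl v z; rewrite mulr_gt0.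
- have [k k0] := pl v (g z); rewrite gK => ->; rewrite pmulr_rgt0 // => h.
  by exists (g z).
Qed.

End Spheres.

(** * The closed forward cone and disjointness of interiors *)

Section Future.
Context {R : realType}.
Implicit Types u v w : lvec R.

Definition future u := [/\ 0 <= bend u, 0 <= cobend u &
  lx u ^+ 2 + ly u ^+ 2 <= bend u * cobend u].

(** Cauchy-Schwarz for the planar parts ([h2]), followed by the arithmetic-geometric inequality for
    the [bend]-[cobend] parts ([h3]). *)
Lemma future_dot u v : future u -> future v -> ldot u v <= 0.
Proof.
move=> [b c q] [b' c' q']; rewrite /ldot subr_le0.
have B0 : 0 <= (bend u * cobend v + cobend u * bend v) / 2.
  by rewrite divr_ge0 // addr_ge0 // mulr_ge0.
apply: (le_trans (ler_norm _)).
rewrite -(ler_pXn2r (ltn0Sn 1)) ?nnegrE ?normr_ge0 // real_normK ?num_real //.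
have h1 : (lx u ^+ 2 + ly u ^+ 2) * (lx v ^+ 2 + ly v ^+ 2) <=
    (bend u * cobend u) * (bend v * cobend v).
  by apply: ler_pM => //; rewrite addr_ge0 // sqr_ge0.
have h2 := sqr_ge0 (lx u * ly v - ly u * lx v).
have h3 := sqr_ge0 (bend u * cobend v - cobend u * bend v).
lra.
Qed.

Lemma future_scale k v : 0 <= k -> future v -> future (lscale k v).
Proof.
move=> k0 [b c q]; split; rewrite /= ?mulr_ge0 //.
by rewrite !exprMn -mulrDr mulrACA -expr2 ler_wpM2l ?sqr_ge0.
Qed.

Lemma blift_future z : future (@blift R z).
Proof.
case: z => [x|]; split => //=; rewrite ?mul1r ?addr_ge0 ?sqr_ge0 //.
by rewrite expr0n addr0 mul0r.
Qed.

Lemma hyp_future p : uhs p -> future (@hyp R p).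
Proof.
move=> h0; have i0 : 0 <= (height p)^-1 by rewrite invr_ge0 ltW.
split => /=.
- by rewrite mulr1.
- by rewrite mulr_ge0 // !addr_ge0 // sqr_ge0.
- rewrite !exprMn -mulrDr mulr1 mulrA -expr2 ler_wpM2l ?sqr_ge0 //.
  by rewrite lerDl sqr_ge0.
Qed.

(** The square of the sum is [2 + 2 * ldot v w <= 0], so the sum lies in one of the two closed
    cones, and the sign of its bend selects the forward one. By [future_dot], no forward vector can
    then have positive products with both spheres. *)
Lemma separated_future v w : ldot v v = 1 -> ldot w w = 1 -> ldot v w <= -1 ->
  0 < bend v + bend w -> future (ladd v w).
Proof.
move=> v1 w1 vw s0.
have q : lx (ladd v w) ^+ 2 + ly (ladd v w) ^+ 2 <=
    bend (ladd v w) * cobend (ladd v w).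
  by move: v1 w1 vw; rewrite /ldot /= => *; lra.
split=> //=; first exact: ltW.
by rewrite -(pmulr_rge0 _ s0); apply: le_trans q; rewrite addr_ge0 // sqr_ge0.
Qed.

End Future.

(** * The two-colored polyhedron and its integral orbit *)

Section Family.
Context {R : realType} (N : nat).
Implicit Types u v w a b : lvec R.

Definition circ (x y : R) : lvec R := LVec 1 (x ^+ 2 + y ^+ 2 - 1) x y.

(* [y < -1] and [2N - 1 < y] *)
Definition lower_line : lvec R := LVec 0 2 0 (-1).
Definition upper_line : lvec R := LVec 0 (2 * (2 * N%:R - 1)) 0 1.

(* Together with [base], the walls of an ideal polyhedron over the rectangle
   [0, 2] x [-1, 2N - 1]; two walls meet only if they have different colours, and
   then at a right angle. *)
Definition mirrors : set (lvec R) := [set a |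
  [\/ a = LVec 0 0 (-1) 0, a = LVec 0 4 1 0 |
      exists2 j : nat, (j <= N)%N & a = circ 1 (2 * j%:R - 1)]].

Definition base : set (lvec R) := [set b |
  [\/ b = lower_line, b = upper_line |
      exists (c : bool) (j : nat), (j < N)%N /\ b = circ (2 * c%:R) (2 * j%:R)]].

Lemma natr_sqr_dist (i j : nat) : i <> j -> 1 <= (i%:R - j%:R : R) ^+ 2.
Proof.
move=> ij; wlog : i j ij / (i < j)%N => [h|].
  have [/h->//|ji|//] := ltngtP i j.
  by rewrite -opprB sqrrN; apply: h => // /esym.
by rewrite -(ler_nat R) -natr1; nra.
Qed.

Lemma mirrors_unit a : mirrors a -> ldot a a = 1.
Proof. by case=> [->|->|[j _ ->]]; rewrite /ldot /=; field. Qed.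

Lemma mirrors_dot a a' : mirrors a -> mirrors a' -> a <> a' -> ldot a a' <= -1.
Proof.
case=> [->|->|[j _ ->]] [->|->|[j' _ ->]] //; rewrite /ldot /= => ne; try by lra.
have := @natr_sqr_dist j j'; move=> /(_ ltac:(by move=> e; apply: ne; rewrite e)).
by lra.
Qed.

Lemma base_unit b : base b -> ldot b b = 1.
Proof. by case=> [->|->|[c [j [_ ->]]]]; rewrite /ldot /=; field. Qed.

Lemma base_dot b b' : base b -> base b' -> b <> b' -> ldot b b' <= -1.
Proof.
have L (j : nat) : (j < N)%N -> 0 <= (j%:R : R) /\ j%:R + 1 <= (N%:R : R).
  by move=> jN; rewrite natr1 ler_nat.
case=> [->|->|[c [j [/L[j0 jN] ->]]]] [->|->|[c' [j' [/L[j0' jN'] ->]]]] //;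
  rewrite /ldot /= => ne; try by lra.
have d := sqr_ge0 (j%:R - j'%:R : R).
case: c c' ne => -[] ne; rewrite /=; try by lra.
- have := @natr_sqr_dist j j'; move=> /(_ ltac:(by move=> e; apply: ne; rewrite e)).
  by lra.
- have := @natr_sqr_dist j j'; move=> /(_ ltac:(by move=> e; apply: ne; rewrite e)).
  by lra.
Qed.

Lemma mirrors_base a b : mirrors a -> base b -> ldot a b = 0 \/ ldot a b <= -2.
Proof.
case=> [->|->|[i iN ->]] [->|->|[c [j [jN ->]]]]; rewrite /ldot /=;
  try by [left; field | case: c => /=; [right; lra | left; field] |
    case: c => /=; [left; field | right; lra]].
- case: i iN => [|i] _; first by left; field.
  by right; rewrite -(natr1 i); have := ler0n R i; lra.
- move: iN; rewrite leq_eqVlt => /predU1P[->|]; first by left; field.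
  by rewrite -(ler_nat R) -natr1 => iN; right; lra.
(* The factors are consecutive integers: their product is 0 when the mirror touches row j, that is
   for i = j or i = j + 1, and at least 2 otherwise. *)
- have E : 1 * (2 * c%:R) + (2 * i%:R - 1) * (2 * j%:R) -
      (1 * ((2 * c%:R) ^+ 2 + (2 * j%:R) ^+ 2 - 1) +
       (1 ^+ 2 + (2 * i%:R - 1) ^+ 2 - 1) * 1) / 2 =
      - 2 * (i%:R - j%:R) * (i%:R - j%:R - 1) :> R.
    by case: c => /=; field.
  rewrite E; have [ij|ji] := leqP i j.
    move: ij; rewrite leq_eqVlt => /predU1P[->|]; first by left; ring.
    by rewrite -(ler_nat R) -natr1 => h; right; nra.
  move: ji; rewrite leq_eqVlt => /predU1P[<-|]; first by left; rewrite -(natr1 j); ring.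
  by rewrite -(ler_nat R) -!natr1 => h; right; nra.
Qed.

Definition spheres := orbit mirrors base.

Lemma spheres_unit v : spheres v -> ldot v v = 1.
Proof. by move=> Pv; apply: (orbit_unit mirrors_unit base_unit Pv). Qed.

Lemma spheres_dot v w : spheres v -> spheres w -> v <> w -> ldot v w <= -1.
Proof.
move=> Pv Pw.
exact: (orbit_dot mirrors_unit mirrors_dot base_unit base_dot mirrors_base Pv Pw).
Qed.

Lemma base_spheres b : base b -> spheres b.
Proof. exact: orbit_base. Qed.
Lemma lower_base : base lower_line. Proof. exact: Or31. Qed.
Lemma upper_base : base upper_line. Proof. exact: Or32. Qed.

(** The two lines add up to 4N times the lift of infinity, which reads off the bend. *)
Lemma dot_lines v : ldot lower_line v + ldot upper_line v = - (2 * N%:R * bend v).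
Proof. by rewrite /ldot /=; field. Qed.

Definition int_lvec v := [/\ bend v \is a Num.int, cobend v \is a Num.int,
  lx v \is a Num.int & ly v \is a Num.int].

Lemma mirrors_int a : mirrors a -> int_lvec a.
Proof.
case=> [->|->|[j _ ->]]; split=> /=;
  by rewrite ?(rpredB, rpredD, rpredM, rpredX, rpredN, rpred1, rpred0, natr_int).
Qed.

Lemma base_int b : base b -> int_lvec b.
Proof.
case=> [->|->|[c [j [_ ->]]]]; split=> /=;
  by rewrite ?(rpredB, rpredD, rpredM, rpredX, rpredN, rpred1, rpred0, natr_int).
Qed.

(** The form takes half-integral values on integral vectors, but a reflection involves only twice
    the form. *)
Lemma lrefl_int a v : int_lvec a -> int_lvec v -> int_lvec (lrefl a v).
Proof.
move=> [a1 a2 a3 a4] [v1 v2 v3 v4].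
have d : - (2 * ldot a v) \is a Num.int.
  rewrite (_ : 2 * _ = 2 * (lx a * lx v + ly a * ly v) -
     (bend a * cobend v + cobend a * bend v)); last by rewrite /ldot; field.
  by rewrite rpredN rpredB // ?rpredM ?rpredD ?rpredM // rpred1.
by split; rewrite /= rpredD // rpredM.
Qed.

Lemma lact_int l v : (forall a, a \in l -> mirrors a) -> int_lvec v -> int_lvec (lact l v).
Proof.
elim: l => //= a l IH h hv; apply: lrefl_int.
  by apply: mirrors_int; apply: h; rewrite inE eqxx.
by apply: IH => // b bl; apply: h; rewrite inE bl orbT.
Qed.

Lemma spheres_int v : spheres v -> int_lvec v.
Proof. by case=> l [b [Al Bb ->]]; apply: lact_int => //; apply: base_int. Qed.

Hypothesis N0 : (0 < N)%N.

(** Any other sphere has product at most -1 with each line, so [dot_lines] makes its bend positive;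
    integrality then raises it to 1. *)
Lemma spheres_bend v : spheres v ->
  [\/ v = lower_line, v = upper_line | 1 <= bend v].
Proof.
move=> Pv; have [->|n1] := eqVneq v lower_line; first exact: Or31.
have [->|n2] := eqVneq v upper_line; first exact: Or32.
apply: Or33.
have h1 := spheres_dot (base_spheres lower_base) Pv (nesym (elimN eqP n1)).
have h2 := spheres_dot (base_spheres upper_base) Pv (nesym (elimN eqP n2)).
have h := dot_lines v; have NR : 0 < (N%:R : R) by rewrite ltr0n.
have b0 : 0 < bend v by nra.
have [bi _ _ _] := spheres_int Pv.
by have /intrP[k kE] := bi; move: b0; rewrite kE ltr0z ler1z.
Qed.

Lemma spheres_bend_ge0 v : spheres v -> 0 <= bend v.
Proof. by move=> /spheres_bend[->|->|]//=; apply: le_trans. Qed.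

(** Stated for forward vectors so as to cover both boundary points and points of hyperbolic
    space. *)
Lemma spheres_separated v w n : spheres v -> spheres w -> future n ->
  0 < ldot v n -> 0 < ldot w n -> v = w.
Proof.
move=> Pv Pw fn vn wn; apply/eqP/negPn/negP => /eqP ne.
suff f : future (ladd v w).
  by have := future_dot f fn; rewrite ldotDl leNgt addr_gt0.
have d := spheres_dot Pv Pw ne.
have v1 := spheres_unit Pv; have w1 := spheres_unit Pw.
have [bv|bv] := ltP 0 (bend v + bend w); first exact: separated_future.
have := spheres_bend_ge0 Pv; have := spheres_bend_ge0 Pw => bw0 bv0.
have NR : 0 <= (N%:R : R) by rewrite ler0n.
(* The bends add up to 0 only for the pair of lines, where [separated_future] does not apply. *)
have f : future (ladd lower_line upper_line).
  by split=> /=; rewrite ?addNr ?addr0 ?expr0n ?mul0r ?addr0 //; lra.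
have fC : ladd upper_line lower_line = ladd lower_line upper_line.
  by apply: lvec_eq => /=; ring.
case: (spheres_bend Pv) (spheres_bend Pw) => [ev|ev|b1] [ew|ew|b2];
  try (by exfalso; lra); by move: ne; rewrite ?ev ?ew ?fC.
Qed.

End Family.

(** * The hyperboloid model and its agreement with the upper half-space *)

Section Hyperboloid.
Context {R : realType}.
Implicit Types (p q : 'rV[R]_(2 + 1)) (a : lvec R).

Lemma hyp_norm p : uhs p -> ldot (hyp p) (hyp p) = -1.
Proof. by move=> h0; rewrite ldotZl ldotZr /ldot /=; field; rewrite gt_eqF. Qed.

Lemma hdistE p q : uhs p -> uhs q -> hdist p q = arcosh (- ldot (hyp p) (hyp q)).
Proof.
move=> hp hq; congr arcosh; rewrite enorm_sqr dot3 ldotZl ldotZr /ldot.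
have hE : height (p - q) = height p - height q by rewrite /height !mxE.
by rewrite hE !mxE /=; field; rewrite !gt_eqF.
Qed.

(** The orthogonal complement of a timelike vector is spacelike: eliminating [cobend u] leaves a sum
    of three squares. *)
Lemma hyp_perp q u : uhs q -> ldot u (hyp q) = 0 -> 0 <= ldot u u.
Proof.
move=> hq; rewrite ldotZr => /eqP; rewrite mulf_eq0 invr_eq0 (gt_eqF hq) /=.
rewrite /ldot /= => /eqP e.
set a := q _ _ in e; set b := q _ _ in e; set h := height q in e.
have -> : lx u * lx u + ly u * ly u - (bend u * cobend u + cobend u * bend u) / 2 =
   (lx u - bend u * a) ^+ 2 + (ly u - bend u * b) ^+ 2 + (bend u * h) ^+ 2.
  have -> : cobend u = 2 * (lx u * a + ly u * b) - bend u * (a ^+ 2 + b ^+ 2 + h ^+ 2).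
    by lra.
  by field.
by rewrite !addr_ge0 // sqr_ge0.
Qed.

(* The determinant of the Gram matrix of [hyp p], [hyp q], [v] is nonpositive. *)
Lemma hyp_gram p q v : uhs p -> uhs q -> ldot v v = 1 ->
  0 <= ldot v (hyp p) -> ldot v (hyp q) <= 0 ->
  1 + ldot v (hyp p) ^+ 2 + ldot v (hyp q) ^+ 2 <= ldot (hyp p) (hyp q) ^+ 2.
Proof.
move=> hp hq v1; have := hyp_norm hp; have := hyp_norm hq.
have c0 := future_dot (hyp_future hp) (hyp_future hq).
have perp u := @hyp_perp q u hq.
move: (hyp p) (hyp q) c0 perp => X Y c0 perp Y1 X1 s0 r0.
(* Projections of [v] and [X] to the orthogonal complement of [Y]. Cauchy-Schwarz holds there, as
   the vector built in [E] has nonnegative square. The cross term has the right sign because [p] and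
   [q] lie on opposite sides of [v]. *)
pose W := ladd v (lscale (ldot v Y) Y).
pose Z := ladd X (lscale (ldot X Y) Y).
have WY : ldot W Y = 0 by rewrite ldotDl ldotZl Y1; ring.
have ZY : ldot Z Y = 0 by rewrite ldotDl ldotZl Y1; ring.
have WW : ldot W W = 1 + ldot v Y ^+ 2.
  by rewrite !(ldotDl, ldotDr, ldotZl, ldotZr) v1 Y1 (ldotC Y v); ring.
have ZZ : ldot Z Z = ldot X Y ^+ 2 - 1.
  by rewrite !(ldotDl, ldotDr, ldotZl, ldotZr) X1 Y1 (ldotC Y X); ring.
have WZ : ldot W Z = ldot v X + ldot v Y * ldot X Y.
  by rewrite !(ldotDl, ldotDr, ldotZl, ldotZr) Y1 (ldotC Y X); ring.
clearbody W Z.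
have E : ldot (ladd (lscale (ldot W W) Z) (lscale (- ldot W Z) W))
    (ladd (lscale (ldot W W) Z) (lscale (- ldot W Z) W)) =
  ldot W W * (ldot W W * ldot Z Z - ldot W Z ^+ 2).
  by rewrite !(ldotDl, ldotDr, ldotZl, ldotZr) (ldotC Z W); ring.
have := perp (ladd (lscale (ldot W W) Z) (lscale (- ldot W Z) W)).
rewrite {}E ldotDl !ldotZl WY ZY !mulr0 addr0 => /(_ erefl).
have W0 : 0 < ldot W W by rewrite WW ltr_pwDl // sqr_ge0.
rewrite pmulr_rge0 // WW ZZ WZ => h.
have p1 : 0 <= ldot v X * (ldot v Y * ldot X Y).
  by rewrite mulr_ge0 // mulr_le0.
lra.
Qed.

Lemma hyp_dot_ge1 p q : uhs p -> uhs q -> 1 <= - ldot (hyp p) (hyp q).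
Proof.
move=> hp hq.
have -> : - ldot (hyp p) (hyp q) = 1 + enorm (p - q) ^+ 2 / (2 * height p * height q).
  rewrite enorm_sqr dot3 ldotZl ldotZr /ldot.
  have hE : height (p - q) = height p - height q by rewrite /height !mxE.
  by rewrite hE !mxE /=; field; rewrite !gt_eqF.
by rewrite lerDl divr_ge0 ?sqr_ge0 // mulr_ge0 ?mulr_ge0 ?ltW.
Qed.

Lemma arcosh_ge (x y : R) : 1 <= x -> x <= y -> arcosh x <= arcosh y.
Proof.
move=> x1 xy; have s z : 1 <= z -> 0 <= z ^+ 2 - 1.
  by move=> z1; rewrite subr_ge0 expr_ge1 // (le_trans ler01).
have y1 := le_trans x1 xy.
rewrite ler_ln ?posrE ?lerD ?ler_wsqrtr ?lerB ?ler_sqr ?nnegrE //; try by rewrite (le_trans ler01).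
- by rewrite ltr_pwDl ?sqrtr_ge0 // (lt_le_trans ltr01).
- by rewrite ltr_pwDl ?sqrtr_ge0 // (lt_le_trans ltr01).
Qed.

Lemma arcosh_gt0 (x : R) : 1 < x -> 0 < arcosh x.
Proof.
by move=> x1; rewrite ln_gt0 // (lt_le_trans x1) // lerDl sqrtr_ge0.
Qed.

Definition hrefl (a : lvec R) : Rhat R (2 + 1) -> Rhat R (2 + 1) :=
  if bend a == 0 then plane_reflection (row_mx (row2 (lx a) (ly a)) 0) (cobend a / 2)
  else sphere_inversion (row_mx (lcenter a) 0) (bend a)^-1.

Definition hact l : Rhat R (2 + 1) -> Rhat R (2 + 1) :=
  foldr (fun a f => hrefl a \o f) id l.

Lemma line_normal_neq0 (a : lvec R) : ldot a a = 1 -> bend a = 0 ->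
  row2 (lx a) (ly a) != 0.
Proof.
move=> a1 b0; apply/eqP => u0.
have : lx a ^+ 2 + ly a ^+ 2 = 1 by rewrite -a1 /ldot b0; ring.
rewrite -(row2E0 (lx a) (ly a)) -{2}(row2E1 (lx a) (ly a)).
by rewrite u0 !mxE expr0n addr0 => /esym/eqP; rewrite oner_eq0.
Qed.

Lemma row_mx_neq0 (u : 'rV[R]_2) : u != 0 -> row_mx u (0 : 'rV[R]_1) != 0.
Proof. by apply: contra => /eqP; rewrite -row_mx0 => /eq_row_mx[-> _]. Qed.

Lemma hrefl_hyperbolic a : ldot a a = 1 -> 0 <= bend a -> hyperbolic_reflection (hrefl a).
Proof.
move=> a1 b0; rewrite /hrefl; case: eqVneq => [e|ne].
  by right; exists (row2 (lx a) (ly a)), (cobend a / 2); rewrite line_normal_neq0.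
by left; exists (lcenter a), (bend a)^-1; rewrite invr_gt0 lt_neqAle eq_sym ne.
Qed.

Lemma hreflK a : ldot a a = 1 -> 0 <= bend a -> involutive (hrefl a).
Proof.
move=> a1 b0; rewrite /hrefl; case: eqVneq => [e|ne].
  by apply: plane_reflectionK; rewrite row_mx_neq0 // line_normal_neq0.
by apply: sphere_inversionK; rewrite invr_gt0 lt_neqAle eq_sym ne.
Qed.

Lemma sphere_lvecE a : ldot a a = 1 -> bend a != 0 ->
  a = sphere_lvec (lcenter a) (bend a)^-1.
Proof.
move=> a1 b0; have u1 : ly a ^+ 2 = 1 + bend a * cobend a - lx a ^+ 2.
  by rewrite -a1 /ldot; field.
by apply: lvec_eq; rewrite /= ?dot2 ?mxE /= ?invrK //; field: u1.
Qed.

Lemma hyp_sphere_inversion (c : 'rV[R]_2) (r : R) p : 0 < r -> uhs p ->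
  exists q, [/\ uhs q, sphere_inversion (row_mx c 0) r (pt p) = pt q &
                hyp q = lrefl (sphere_lvec c r) (hyp p)].
Proof.
move=> r0 hp; have h0 : height p != 0 by rewrite gt_eqF.
set c' := row_mx _ _.
have ch : c' 0 (rshift 2 0) = 0 by rewrite /c' row_mxEr mxE.
have cl i : c' 0 (lshift 1 i) = c 0 i by rewrite /c' row_mxEl.
clearbody c'; have pc : p != c'.
  by apply/eqP => pc; move: hp; rewrite /uhs /= pc /height ch ltxx.
have d0 : 0 < dot (p - c') (p - c') by rewrite dot_gt0 // subr_eq0.
rewrite sphere_inversion_pt //; set k := _ / _; exists (c' + k *: (p - c')).
have k0 : 0 < k by rewrite divr_gt0 // exprn_gt0.
have hq : height (c' + k *: (p - c')) = k * height p.
  by rewrite /height !mxE ch add0r subr0.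
split=> //; first by rewrite /uhs /= hq mulr_gt0.
have kE : k = r ^+ 2 / ((p 0 (lshift 1 0) - c 0 0) ^+ 2 +
    (p 0 (lshift 1 1) - c 0 1) ^+ 2 + height p ^+ 2).
  rewrite /k; congr (_ / _).
  by rewrite dot3 /height !mxE !cl ch; ring.
have dn : (p 0 (lshift 1 0) - c 0 0) ^+ 2 +
    (p 0 (lshift 1 1) - c 0 1) ^+ 2 + height p ^+ 2 != 0.
  apply/eqP => e; move: k0; rewrite kE e invr0 mulr0 ltxx //.
have rn : r != 0 by rewrite gt_eqF.
rewrite /hyp hq; apply: lvec_eq; rewrite /lrefl /ldot /= ?mxE ?cl kE ?dot2;
  by field; rewrite ?rn ?h0 ?dn.
Qed.

Lemma hyp_plane_reflection (a : lvec R) p : ldot a a = 1 -> bend a = 0 -> uhs p ->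
  exists q, [/\ uhs q,
    plane_reflection (row_mx (row2 (lx a) (ly a)) 0) (cobend a / 2) (pt p) = pt q &
    hyp q = lrefl a (hyp p)].
Proof.
move=> a1 e hp; have h0 : height p != 0 by rewrite gt_eqF.
have u1 : ly a ^+ 2 = 1 - lx a ^+ 2 by rewrite -a1 /ldot e; ring.
set u := row_mx _ _.
have uh : u 0 (rshift 2 0) = 0 by rewrite /u row_mxEr mxE.
have ul0 : u 0 (lshift 1 0) = lx a by rewrite /u row_mxEl mxE.
have ul1 : u 0 (lshift 1 1) = ly a by rewrite /u row_mxEl mxE.
clearbody u; have un : enorm u ^+ 2 = 1.
  by rewrite enorm_sqr dot3 /height uh ul0 ul1; ring: u1.
rewrite /plane_reflection /= un divr1.
set k := 2 * _; have kE : k = 2 * (lx a * p 0 (lshift 1 0) +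
    ly a * p 0 (lshift 1 1) - cobend a / 2).
  by rewrite /k dot3 /height uh ul0 ul1; ring.
exists (p - k *: u).
have hq : height (p - k *: u) = height p.
  by rewrite /height !mxE uh mulr0 subr0.
split=> //; first by rewrite /uhs /= hq.
rewrite /hyp hq; apply: lvec_eq; rewrite /lrefl /ldot /= ?mxE ?ul0 ?ul1 e ?kE;
  by field: u1.
Qed.

(** In contrast with boundary points, no scalar appears: all points of the hyperboloid have the same
    norm. *)
Lemma hrefl_hyp a p : ldot a a = 1 -> 0 <= bend a -> uhs p ->
  exists q, [/\ uhs q, hrefl a (pt p) = pt q & hyp q = lrefl a (hyp p)].
Proof.
move=> a1 b0 hp; rewrite /hrefl; case: eqVneq => [e|ne].
  exact: hyp_plane_reflection.
rewrite {3}(sphere_lvecE a1 ne); apply: hyp_sphere_inversion => //.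
by rewrite invr_gt0 lt_neqAle eq_sym ne.
Qed.

End Hyperboloid.

(** * Finiteness of bounded sets of integral vectors *)

Section Finiteness.
Context {R : realType}.

Lemma finite_argmin (T : eqType) (A : set T) (f : T -> R) :
  finite_set A -> A !=set0 -> exists2 x, A x & forall y, A y -> f x <= f y.
Proof.
move=> /finite_seqP[s ->]; elim: s => [[x]//|a s IH] _.
case: s IH => [_|b s IH]; first by exists a => [|y] /=; rewrite inE ?eqxx // => /eqP ->.
have [|x xs xm] := IH; first by exists b; rewrite /= inE eqxx.
have [ax|xa] := leP (f a) (f x).
  exists a => [|y /=]; first by rewrite /= inE eqxx.
  by rewrite inE => /predU1P[->//|/xm]; apply: le_trans.
exists x => [|y /=]; first by rewrite /= inE; move: xs => /= ->; rewrite orbT.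
by rewrite inE => /predU1P[->|/xm//]; apply: ltW.
Qed.

Lemma finite_int_lvec (M : R) : finite_set [set v : lvec R |
  int_lvec v /\ [/\ `|bend v| <= M, `|cobend v| <= M, `|lx v| <= M & `|ly v| <= M]].
Proof.
have [n Mn] : exists n : nat, M <= n%:R.
  by exists (Num.bound `|M|); rewrite (le_trans (ler_norm _)) // ltW // archi_boundP.
pose I := (fun i : nat => i%:Z - n%:Z) @` `I_(n + n).+1.
have fI : finite_set I by apply: finite_image; apply: finite_II.
have I_ x : x \is a Num.int -> `|x| <= M -> exists2 k : int, I k & x = k%:~R.
  move=> /intrP[k ->] kM; exists k => //.
  have : `|k| <= n%:Z.
    by have := le_trans kM Mn; rewrite -intr_norm pmulrn ler_int.
  rewrite ler_norml => /andP[k1 k2]; exists `|(k + n%:Z)%R|%N.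
    rewrite /= ltnS -lez_nat gez0_abs; last by rewrite -lerBlDr sub0r.
    by rewrite PoszD lerD2r.
  by rewrite gez0_abs ?addrK // -lerBlDr sub0r.
apply: (@sub_finite_set _ _ ((fun t : int * int * (int * int) =>
  LVec t.1.1%:~R t.1.2%:~R t.2.1%:~R t.2.2%:~R) @` ((I `*` I) `*` (I `*` I)))).
  move=> v [[b1 b2 b3 b4] [/(I_ _ b1)[k1 i1 e1] /(I_ _ b2)[k2 i2 e2]
    /(I_ _ b3)[k3 i3 e3] /(I_ _ b4)[k4 i4 e4]]].
  by exists ((k1, k2), (k3, k4)) => //; apply: lvec_eq.
by apply: finite_image; do 2?apply: finite_setX.
Qed.

(** Since [hyp p] is timelike, it cuts bounded slices from the forward cone. Multiplying the
    hypothesis by [bend m] and completing squares bounds the bend, then the center coordinates, then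
    the cobend. *)
Lemma future_bounded (p : 'rV[R]_(2 + 1)) (F : R) : uhs p -> exists M, forall m,
  future m -> - ldot m (hyp p) <= F ->
  [/\ `|bend m| <= M, `|cobend m| <= M, `|lx m| <= M & `|ly m| <= M].
Proof.
move=> hp; set h := height p.
have h0 : 0 < h by [].
pose x := p 0 (lshift 1 0); pose y := p 0 (lshift 1 1).
pose K := `|2 * h * F|; have K0 : 0 <= K by rewrite normr_ge0.
pose B := K / h ^+ 2; have B0 : 0 <= B by rewrite divr_ge0 // sqr_ge0.
pose L := B * (`|x| + `|y|) + K / h.
have Kh0 : 0 <= K / h by rewrite divr_ge0 // ltW.
have L0 : 0 <= L by rewrite addr_ge0 // mulr_ge0 // addr_ge0.
pose C := K + 2 * L * (`|x| + `|y|).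
have C0 : 0 <= C by rewrite addr_ge0 // !mulr_ge0 // addr_ge0.
exists (B + L + C) => m [b0 c0 q] mF.
have e : bend m * (x ^+ 2 + y ^+ 2 + h ^+ 2) + cobend m - 2 * (lx m * x + ly m * y) <= K.
  rewrite (le_trans _ (ler_norm _)) //.
  rewrite -(ler_pdivrMl _ _ (_ : 0 < 2 * h)); last by rewrite mulr_gt0.
  apply: le_trans mF; rewrite ldotZr /ldot /= -/x -/y -/h le_eqVlt; apply/orP; left.
  by apply/eqP; field; rewrite gt_eqF.
have e2 : (lx m - bend m * x) ^+ 2 + (ly m - bend m * y) ^+ 2 + (bend m * h) ^+ 2 <= bend m * K.
  have := ler_wpM2l b0 e; lra.
have s1 := sqr_ge0 (lx m - bend m * x).
have s2 := sqr_ge0 (ly m - bend m * y).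
have s3 := sqr_ge0 (bend m * h).
have bB : bend m <= B.
  rewrite ler_pdivlMr ?exprn_gt0 //; move: b0; rewrite le_eqVlt => /predU1P[<-|b0].
    by rewrite mul0r.
  by rewrite -(ler_pM2l b0); lra.
have KB : bend m * K <= (K / h) ^+ 2.
  by rewrite (le_trans (ler_wpM2r K0 bB)) // /B expr_div_n expr2 mulrAC.
have bnd (l z : R) : (l - bend m * z) ^+ 2 <= (K / h) ^+ 2 -> `|z| <= `|x| + `|y| -> `|l| <= L.
  move=> h1 zb; have : `|l - bend m * z| <= K / h.
    by rewrite -(ler_pXn2r (ltn0Sn 1)) ?nnegrE // real_normK ?num_real.
  have -> : l = bend m * z + (l - bend m * z) by ring.
  rewrite (addrC (bend m * z) (l - _)) addrK => h2.
  rewrite addrC (le_trans (ler_normD _ _)) // lerD // normrM (ger0_norm b0).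
  by rewrite ler_pM.
have lxL : `|lx m| <= L by apply: (bnd _ x); rewrite ?lerDl //; lra.
have lyL : `|ly m| <= L by apply: (bnd _ y); rewrite ?lerDr //; lra.
split.
- by rewrite ger0_norm //; lra.
- rewrite ger0_norm //.
  have q1 : 0 <= bend m * (x ^+ 2 + y ^+ 2 + h ^+ 2).
    by rewrite mulr_ge0 // !addr_ge0 // sqr_ge0.
  have q2 : lx m * x <= L * `|x|.
    by rewrite (le_trans (ler_norm _)) // normrM ler_wpM2r.
  have q3 : ly m * y <= L * `|y|.
    by rewrite (le_trans (ler_norm _)) // normrM ler_wpM2r.
  by rewrite /C; lra.
- lra.
- lra.
Qed.

End Finiteness.

(** * The reflection group: discreteness and fundamental domain *)

Section Group.
Context {R : realType} (N : nat).
Hypothesis N0 : (0 < N)%N.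
Local Notation mirrors := (@mirrors R N).
Implicit Types (a : lvec R) (l : seq (lvec R)) (p q : 'rV[R]_(2 + 1)).

Definition refl_group : set (Rhat R (2 + 1) -> Rhat R (2 + 1)) :=
  gen_group [set hrefl a | a in mirrors].

Lemma mirrors_bend a : mirrors a -> 0 <= bend a.
Proof. by case=> [->|->|[j _ ->]]. Qed.

Lemma mirrors_hreflK a : mirrors a -> involutive (hrefl a).
Proof. by move=> Aa; apply: hreflK; [apply: mirrors_unit Aa|apply: mirrors_bend]. Qed.

Lemma hact_cat l1 l2 z : hact (l1 ++ l2) z = hact l1 (hact l2 z).
Proof. by elim: l1 => //= a l1 ->. Qed.

Lemma hactK l : (forall a, a \in l -> mirrors a) -> cancel (hact l) (hact (rev l)).
Proof.
elim: l => [//|a l IH] Al z; rewrite rev_cons -cats1 hact_cat /= mirrors_hreflK.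
  by apply: IH => b bl; apply: Al; rewrite inE bl orbT.
by apply: Al; rewrite inE eqxx.
Qed.

Lemma hact_hyp l p : (forall a, a \in l -> mirrors a) -> uhs p ->
  exists q, [/\ uhs q, hact l (pt p) = pt q & hyp q = lact l (hyp p)].
Proof.
elim: l => [|a l IH] Al hp; first by exists p.
have [|q [hq e1 e2]] := IH _ hp; first by move=> b bl; apply: Al; rewrite inE bl orbT.
have Aa : mirrors a by apply: Al; rewrite inE eqxx.
have [q' [hq' e1' e2']] := hrefl_hyp (mirrors_unit Aa) (mirrors_bend Aa) hq.
by exists q'; rewrite /= e1 e2'; rewrite e2.
Qed.

Lemma refl_groupP g : refl_group g <->
  exists2 l, (forall a, a \in l -> mirrors a) & g = hact l.
Proof.
split=> [|[l Al ->]]; last first.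
  elim: l Al => [|a l IH] Al; first exact: gen_group_id.
  apply: gen_group_comp; last by apply: IH => b bl; apply: Al; rewrite inE bl orbT.
  by apply: gen_group_mem; exists a => //; apply: Al; rewrite inE eqxx.
elim=> {g} [|g [a Aa <-]|f g _ [l1 Al1 ->] _ [l2 Al2 ->]|f g _ [l Al ->] fg gf].
- by exists [::].
- by exists [:: a] => // b; rewrite inE => /eqP ->.
- exists (l1 ++ l2) => [b|]; first by rewrite mem_cat => /orP[/Al1|/Al2].
  by apply/funext => z; rewrite hact_cat.
- exists (rev l) => [b|]; first by rewrite mem_rev => /Al.
  by apply/funext => z; rewrite -[z in RHS]gf hactK.
Qed.

(* An integral multiple of [hyp] of the base point, inside the fundamental
   polyhedron of the group. *)
Definition base_lvec : lvec R := LVec 1 (2 * N%:R + 1) 1 0.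
Definition basept : 'rV[R]_(2 + 1) := row_mx (row2 1 0) (const_mx (Num.sqrt (2 * N%:R))).

Lemma sqrt2N_gt0 : 0 < Num.sqrt (2 * N%:R : R).
Proof. by rewrite sqrtr_gt0 mulr_gt0 // ltr0n. Qed.

Lemma height_basept : height basept = Num.sqrt (2 * N%:R).
Proof. by rewrite /height row_mxEr mxE. Qed.

Lemma uhs_basept : uhs basept.
Proof. by rewrite /uhs /= height_basept sqrt2N_gt0. Qed.

Lemma hyp_basept : hyp basept = lscale (Num.sqrt (2 * N%:R))^-1 base_lvec.
Proof.
rewrite /hyp height_basept /basept !row_mxEl !mxE /= sqr_sqrtr; last first.
  by rewrite mulr_ge0 // ler0n.
by congr lscale; apply: lvec_eq => //=; ring.
Qed.

Lemma mirrors_base_lvec a : mirrors a -> ldot a base_lvec <= -1.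
Proof.
case=> [->|->|[j jN ->]]; rewrite /ldot /=; try by lra.
have : 1 <= (N%:R : R) by rewrite ler1n.
have : 1 <= (2 * j%:R - 1 : R) ^+ 2; last by lra.
case: j jN => [|j] _; first by lra.
by rewrite -(natr1 j); have := ler0n R j; nra.
Qed.

Lemma mirrors_basept a : mirrors a ->
  ldot a (hyp basept) <= - (Num.sqrt (2 * N%:R))^-1.
Proof.
move=> Aa; rewrite hyp_basept ldotZr -mulrN1.
by rewrite ler_wpM2l ?mirrors_base_lvec // invr_ge0 ltW // sqrt2N_gt0.
Qed.

(** One test point suffices. A nonempty reduced word carries [basept] across the mirror of its first
    letter, whereas [basept] has product at most [- s^-1] with every mirror; [hyp_gram] then keeps
    the hyperbolic cosine of the displacement above [c]. *)
Lemma refl_group_discrete : discrete_group refl_group.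
Proof.
have s0 := sqrt2N_gt0; set s := Num.sqrt _ in s0.
pose c := Num.sqrt (1 + s ^- 2).
have s20 : 0 < s ^- 2 by rewrite invr_gt0 exprn_gt0.
have c1 : 1 < c by rewrite -[X in X < _]sqrtr1 ltr_sqrt ?ltrDl // addr_gt0.
exists [set basept], (arcosh c); split.
- exact: compact_set1.
- by move=> _ ->; apply: uhs_basept.
- exact: arcosh_gt0.
move=> g /refl_groupP[l Al ->] H.
have [a Aa||l' gl' e] := @good_reduce_strict _ mirrors (@mirrors_unit R N)
  (@mirrors_dot R N) _ (@hrefl R) (hyp basept) l _ _ Al.
- exact: mirrors_hreflK.
- move=> a Aa; apply: le_lt_trans (mirrors_basept Aa) _.
  by rewrite oppr_lt0 invr_gt0.
rewrite -/(hact l) -/(hact l') in e; rewrite e in H *; case: l' gl' e H => [//|a l'] gl' _ H.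
have [q [hq e1 e2]] := hact_hyp (fun b => @good_in _ _ _ _ b gl') uhs_basept.
have Aa : mirrors a by case: gl'.
have dom : dominated mirrors (hyp basept).
  move=> b Ab; apply: le_trans (mirrors_basept Ab) _.
  by rewrite oppr_le0 invr_ge0 ltW.
have [pos _] := good_head (@mirrors_unit R N) (@mirrors_dot R N) dom gl'.
have := H _ _ erefl e1; rewrite (hdistE uhs_basept hq) ltNge => /negP[].
have h1 := hyp_dot_ge1 uhs_basept hq.
apply: arcosh_ge; first exact: ltW.
rewrite /c -(ler_pXn2r (ltn0Sn 1)) ?nnegrE ?sqrtr_ge0 ?(le_trans ler01) //.
rewrite sqr_sqrtr ?addr_ge0 ?(ltW s20) // sqrrN.
rewrite -e2 in pos; have nb := mirrors_basept Aa.
have := hyp_gram hq uhs_basept (mirrors_unit Aa) (ltW pos).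
move=> /(_ ltac:(apply: le_trans nb _; rewrite oppr_le0 invr_ge0 ltW //)).
rewrite (ldotC (hyp q)) => h; apply: le_trans h.
rewrite -addrA lerD2l -[X in X <= _]add0r lerD ?sqr_ge0 //.
rewrite -exprVn -(sqrrN (ldot _ _)) ler_pXn2r ?nnegrE ?invr_ge0 ?(ltW s0) //.
  by rewrite lerNr.
by rewrite oppr_ge0 (le_trans nb) // oppr_le0 invr_ge0 ltW.
Qed.

Lemma refl_group_reflection : reflection_group refl_group.
Proof.
split; last exact: refl_group_discrete.
exists [set hrefl a | a in mirrors] => // _ [a Aa <-].
by apply: hrefl_hyperbolic; [apply: mirrors_unit Aa|apply: mirrors_bend].
Qed.

(* Descent: the translate of [basept] closest to [p]. *)
Lemma fold_uhs p : uhs p -> exists l q, [/\ forall a, a \in l -> mirrors a,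
  uhs q, hact l (pt p) = pt q, hyp q = lact l (hyp p) &
  forall a, mirrors a -> ldot a (hyp q) <= 0].
Proof.
move=> hp; pose f m := - ldot m (hyp p).
(* Only translates at least as close as the initial one are kept, so that integrality makes the set
   finite and a minimum exists. *)
pose S := [set m | (exists2 l, (forall a, a \in l -> mirrors a) & m = lact l base_lvec)
  /\ f m <= f base_lvec].
have Sfin : finite_set S.
  have [M HM] := future_bounded (f base_lvec) hp.
  apply: sub_finite_set (finite_int_lvec M) => _ [[l Al ->] fm]; split.
    by apply: lact_int Al _; split; rewrite /= ?(rpredD, rpredM, natr_int, rpred1, rpred0).
  apply: HM => //; have s0 := sqrt2N_gt0.
  have -> : base_lvec = lscale (Num.sqrt (2 * N%:R)) (hyp basept).
    by rewrite hyp_basept; apply: lvec_eq; rewrite /= mulrA divff ?mul1r ?gt_eqF.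
  have [q [hq _ e]] := hact_hyp Al uhs_basept; rewrite lactZ -e.
  by apply: future_scale (hyp_future hq); apply: ltW.
have [|m [[l Al mE] mf] mmin] := finite_argmin f Sfin.
  by exists base_lvec; split => //; exists [::].
have Arl a : a \in rev l -> mirrors a by rewrite mem_rev; apply: Al.
have [q [hq e1 e2]] := hact_hyp Arl hp.
exists (rev l), q; split => // a Aa; rewrite leNgt; apply/negP => pos.
(* If [q] were beyond the mirror [a], reflecting the base point in [a] would give a strictly closer
   translate. *)
pose m1 := lact l (lrefl a base_lvec).
have fm1 : f m1 < f m.
  rewrite /f mE /m1 !lact_sym -e2 ltrN2 lrefl_sym ldot_lrefl ltrDl oppr_gt0.
  rewrite (ldotC base_lvec a); have := mirrors_base_lvec Aa; nra.
have := mmin m1; rewrite leNgt fm1 => /(_ _)/negP; apply; split=> //.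
  exists (l ++ [:: a]); last by rewrite lact_cat.
  by move=> b; rewrite mem_cat inE => /orP[/Al|/eqP->].
by apply: ltW; apply: lt_le_trans mf.
Qed.

End Group.

(** * Distance to a circle from values of its equation, uniformly in the bend *)

Section Near.
Context {R : realType}.
Implicit Types (v : lvec R) (x y : 'rV[R]_2) (p : 'rV[R]_(2 + 1)).

Definition close (e : R) x y := `|y 0 0 - x 0 0| <= e /\ `|y 0 1 - x 0 1| <= e.

(** With [grady], the gradient at [x] of the function [y |-> ldot v (blift (pt y))]. *)
Definition gradx v x := lx v - bend v * x 0 0.
Definition grady v x := ly v - bend v * x 0 1.

Lemma grad_norm v x : ldot v v = 1 ->
  gradx v x ^+ 2 + grady v x ^+ 2 = 1 - 2 * bend v * ldot v (blift (pt x)).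
Proof.
move=> v1; have u1 : ly v ^+ 2 = 1 + bend v * cobend v - lx v ^+ 2.
  by rewrite -v1 /ldot; field.
by rewrite /ldot /gradx /grady /=; field: u1.
Qed.

Lemma blift_shift v x (s t : R) : ldot v (blift (pt (row2 (x 0 0 + s) (x 0 1 + t)))) =
  ldot v (blift (pt x)) + s * gradx v x + t * grady v x - bend v * (s ^+ 2 + t ^+ 2) / 2.
Proof. by rewrite /ldot /gradx /grady /= !mxE /=; field. Qed.

Lemma close_shift e x (s t : R) : `|s| <= e -> `|t| <= e ->
  close e x (row2 (x 0 0 + s) (x 0 1 + t)).
Proof. by move=> se te; split; rewrite !mxE /= addrAC subrr add0r. Qed.

Lemma closexx e x : 0 <= e -> close e x x.
Proof. by move=> e0; split; rewrite subrr normr0. Qed.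

(* Steepest ascent among the four axis directions. *)
Lemma grad_axis v x : exists s t : R, [/\ `|s| <= 1, `|t| <= 1, s ^+ 2 + t ^+ 2 = 1,
  `|gradx v x| <= s * gradx v x + t * grady v x &
  `|grady v x| <= s * gradx v x + t * grady v x].
Proof.
set a := gradx v x; set b := grady v x.
have sg (z : R) : exists s : R, [/\ `|s| = 1, s ^+ 2 = 1 & s * z = `|z|].
  have [z0|z0] := leP 0 z; first by exists 1; rewrite normr1 expr1n mul1r ger0_norm.
  by exists (-1); rewrite normrN1 sqrrN expr1n mulN1r ltr0_norm.
have [ab|ba] := leP `|b| `|a|.
  have [s [s1 s2 sa]] := sg a; exists s, 0.
  by rewrite s1 s2 normr0 expr0n addr0 mul0r addr0 sa.
have [t [t1 t2 tb]] := sg b; exists 0, t.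
rewrite t1 t2 normr0 expr0n add0r mul0r add0r tb; split=> //; exact: ltW.
Qed.

Lemma sqr_le_norm (a m : R) : `|a| <= m -> a ^+ 2 <= m ^+ 2.
Proof.
by move=> am; rewrite -real_normK ?num_real // ler_pXn2r ?nnegrE // (le_trans _ am).
Qed.

(** If the gradient is small compared with [bend v * e], the center is within reach. Otherwise a
    step of length e along the best axis gains at least e * m / 2, and m is at least 1/2. *)
Lemma near_inside v x (e : R) : ldot v v = 1 -> 0 <= bend v -> 0 < e ->
  - (e / 4) < ldot v (blift (pt x)) ->
  exists2 y, close e x y & 0 < ldot v (blift (pt y)).
Proof.
move=> v1 b0 e0 q; have [q0|q0] := ltP 0 (ldot v (blift (pt x))).
  by exists x => //; apply: closexx; apply: ltW.
have G := grad_norm x v1; have [s [t [s1 t1 st xm ym]]] := grad_axis v x.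
have E := blift_shift v x.
move: (ldot v (blift (pt x))) q q0 G E => q qe q0 G E.
set m := _ + _ in xm ym; have m0 : 0 <= m by apply: le_trans xm.
have gm := lerD (sqr_le_norm xm) (sqr_le_norm ym).
have bq : 0 <= - (bend v * q) by rewrite -mulrN mulr_ge0 // oppr_ge0.
have [mb|bm] := leP m (bend v * e).
  have b1 : 0 < bend v.
    rewrite lt_neqAle b0 andbT; apply/eqP => bE.
    have mE : m = 0 by apply/eqP; rewrite eq_le m0 andbT (le_trans mb) // -bE mul0r.
    by move: gm; rewrite G -bE mE; lra.
  have gl (z : R) : `|z| <= m -> `|z / bend v| <= e.
    by move=> zm; rewrite normrM normfV (gtr0_norm b1) ler_pdivrMr // mulrC (le_trans zm).
  exists (row2 (x 0 0 + gradx v x / bend v) (x 0 1 + grady v x / bend v)).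
    by apply: close_shift; apply: gl.
  rewrite E; set a := gradx v x in G *; set b := grady v x in G *.
  have -> : q + a / bend v * a + b / bend v * b - bend v * ((a / bend v) ^+ 2 +
     (b / bend v) ^+ 2) / 2 = q + (a ^+ 2 + b ^+ 2) / (2 * bend v).
    by field; rewrite gt_eqF.
  rewrite G (_ : _ + _ = (2 * bend v)^-1) ?invr_gt0 ?mulr_gt0 //.
  by field; rewrite gt_eqF.
exists (row2 (x 0 0 + e * s) (x 0 1 + e * t)).
  by apply: close_shift; rewrite normrM (gtr0_norm e0) ger_pMr.
rewrite E !exprMn -mulrDr st.
have -> : q + e * s * gradx v x + e * t * grady v x - bend v * (e ^+ 2 * 1) / 2 =
  q + e * m - bend v * e * e / 2 by rewrite /m; field.
have m2 : 2^-1 <= m by rewrite -(ler_pXn2r (ltn0Sn 1)) ?nnegrE //; lra.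
have h1 : bend v * e * e <= m * e by rewrite ler_wpM2r // ltW.
have h2 : e * 2^-1 <= e * m by rewrite ler_pM2l.
lra.
Qed.

(** A step down the steepest axis. Deep inside the circle the gradient may vanish, and the quadratic
    term provides the decrease instead: this is the case [bend v * q > 4^-1]. *)
Lemma near_outside v x (e : R) : ldot v v = 1 -> 0 <= bend v -> 0 < e ->
  ldot v (blift (pt x)) < e / 4 ->
  exists2 y, close e x y & ldot v (blift (pt y)) <= 0.
Proof.
move=> v1 b0 e0 q; have [q0|q0] := leP (ldot v (blift (pt x))) 0.
  by exists x => //; apply: closexx; apply: ltW.
have G := grad_norm x v1; have [s [t [s1 t1 st xm ym]]] := grad_axis v x.
have E := blift_shift v x.
move: (ldot v (blift (pt x))) q q0 G E => q qe q0 G E.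
set m := _ + _ in xm ym; have m0 : 0 <= m by apply: le_trans xm.
have gm := lerD (sqr_le_norm xm) (sqr_le_norm ym).
exists (row2 (x 0 0 + - e * s) (x 0 1 + - e * t)).
  by apply: close_shift; rewrite normrM normrN (gtr0_norm e0) ger_pMr.
rewrite E !exprMn sqrrN -mulrDr st.
have -> : q + - e * s * gradx v x + - e * t * grady v x - bend v * (e ^+ 2 * 1) / 2 =
  q - e * m - bend v * e ^+ 2 / 2 by rewrite /m; field.
have be : 0 <= bend v * e ^+ 2 by rewrite mulr_ge0 // sqr_ge0.
have em : 0 <= e * m by rewrite mulr_ge0 // ltW.
have [bq|bq] := leP (bend v * q) 4^-1.
  have m2 : 2^-1 <= m by rewrite -(ler_pXn2r (ltn0Sn 1)) ?nnegrE //; lra.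
  have h2 : e * 2^-1 <= e * m by rewrite ler_pM2l.
  by lra.
suff : q * q <= q * (bend v * e ^+ 2 / 2) by rewrite ler_pM2l //; lra.
have h3 : e ^+ 2 * 4^-1 <= e ^+ 2 * (bend v * q) by rewrite ler_wpM2l ?sqr_ge0 // ltW.
have h4 : q * q <= e / 4 * (e / 4) by rewrite ler_pM // ltW.
have := sqr_ge0 e; lra.
Qed.

Lemma quadratic_ivt (a b c : R) : a <= 0 -> 0 <= a + b + c ->
  exists2 s, 0 <= s <= 1 & a + b * s + c * s ^+ 2 = 0.
Proof.
move=> a0 abc; pose p : {poly R} := a%:P + b *: 'X + c *: 'X^2.
have pE s : p.[s] = a + b * s + c * s ^+ 2 by rewrite /p !hornerE.
have [||s s01 /rootP rs] := @poly_ivt R p 0 1.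
- by [].
- by rewrite !pE expr0n !mulr0 !addr0 a0 expr1n !mulr1.
- by exists s => //; rewrite -pE.
Qed.

Lemma segment_zero v x y : ldot v (blift (pt x)) <= 0 -> 0 <= ldot v (blift (pt y)) ->
  exists2 s, 0 <= s <= 1 & ldot v (blift (pt (row2 (x 0 0 + s * (y 0 0 - x 0 0))
    (x 0 1 + s * (y 0 1 - x 0 1))))) = 0.
Proof.
move=> vx vy; set d0 := _ - _; set d1 := _ - _ in vy *.
have E : ldot v (blift (pt y)) = ldot v (blift (pt (row2 (x 0 0 + d0) (x 0 1 + d1)))).
  by congr (ldot v (blift (pt _))); apply: row2P; rewrite mxE /= /d0 /d1; ring.
rewrite E blift_shift in vy.
have [|s s01 sE] := quadratic_ivt (b := d0 * gradx v x + d1 * grady v x)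
  (c := - (bend v * (d0 ^+ 2 + d1 ^+ 2) / 2)) vx; first by lra.
by exists s => //; rewrite blift_shift -{}sE; field.
Qed.

Lemma near_carrier v x (e : R) : ldot v v = 1 -> 0 <= bend v -> 0 < e ->
  `|ldot v (blift (pt x))| < e / 8 ->
  exists2 y, close e x y & ldot v (blift (pt y)) = 0.
Proof.
move=> v1 b0 e0; rewrite ltr_norml => /andP[q1 q2].
have e2 : 0 < e / 2 by rewrite divr_gt0.
have [|y [yx yy] vy] := @near_inside v x (e / 2) v1 b0 e2; first by lra.
have [|z [zx zy] vz] := @near_outside v x (e / 2) v1 b0 e2; first by lra.
have [s /andP[s0 s1] sE] := segment_zero vz (ltW vy).
eexists; last exact: sE.
have L (a b c : R) : `|b - a| <= e / 2 -> `|c - a| <= e / 2 ->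
    `|b + s * (c - b) - a| <= e.
  rewrite !ler_norml => /andP[h1 h2] /andP[h3 h4].
  have k1 : s * (c - b) <= s * e by rewrite ler_wpM2l //; lra.
  have k2 : s * (b - c) <= s * e by rewrite ler_wpM2l //; lra.
  have k3 : 0 <= (1 - s) * (b - a + e / 2) by rewrite mulr_ge0 //; lra.
  have k4 : 0 <= (1 - s) * (a - b + e / 2) by rewrite mulr_ge0 //; lra.
  have k5 : 0 <= s * (c - a + e / 2) by rewrite mulr_ge0 //; lra.
  have k6 : 0 <= s * (a - c + e / 2) by rewrite mulr_ge0 //; lra.
  by apply/andP; split; lra.
by split; rewrite mxE /=; apply: L.
Qed.

Definition proj p : 'rV[R]_2 := row2 (p 0 (lshift 1 0)) (p 0 (lshift 1 1)).

Lemma hyp_proj v p : uhs p ->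
  ldot v (blift (pt (proj p))) = height p * ldot v (hyp p) + bend v * height p ^+ 2 / 2.
Proof. by move=> hp; rewrite ldotZr /ldot /= !mxE /=; field; rewrite gt_eqF. Qed.

(** The term [bend v * height p ^+ 2 / 2] of [hyp_proj] has no a priori bound, but the square of the
    gradient is nonnegative, so twice the bend times the value q at the foot of [p] is at most 1.
    This turns the estimate into a quadratic inequality for q. *)
Lemma hyp_near_carrier v p (K e : R) : ldot v v = 1 -> 0 <= bend v -> uhs p ->
  `|ldot v (hyp p)| <= K -> 8 * (K + 1) * height p < e ->
  exists2 y, close e (proj p) y & ldot v (blift (pt y)) = 0.
Proof.
move=> v1 b0 hp vK te; have h0 : 0 < height p by [].
have K0 : 0 <= K by apply: le_trans vK.
have e0 : 0 < e by apply: le_lt_trans te; rewrite !mulr_ge0 // ?addr_ge0 // ltW.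
apply: near_carrier => //; have := hyp_proj v hp.
have G := grad_norm (proj p) v1.
have G0 : 0 <= 1 - 2 * bend v * ldot v (blift (pt (proj p))).
  by rewrite -G addr_ge0 // sqr_ge0.
move: (ldot v (blift (pt (proj p)))) G0 {G} => q G0 qE.
move: (height p) h0 te qE => t t0 te qE.
move: vK; rewrite ler_norml => /andP[k1 k2].
have bt : 0 <= bend v * t ^+ 2 by rewrite mulr_ge0 // sqr_ge0.
have l1 : t * - K <= t * ldot v (hyp p) by rewrite ler_pM2l.
have l2 : t * ldot v (hyp p) <= t * K by rewrite ler_pM2l.
suff : q <= (K + 1) * t by rewrite ltr_norml => ?; apply/andP; split; lra.
rewrite leNgt; apply/negP => qt; have q0 : 0 < q.
  by apply: lt_trans qt; rewrite mulr_gt0 // ltr_wpDl.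
have qq : q * q <= q * (t * K) + t ^+ 2 / 4.
  have : q * (bend v * t ^+ 2) <= t ^+ 2 / 2.
    have := ler_wpM2r (sqr_ge0 t) G0; lra.
  have : q * q <= q * (t * K + bend v * t ^+ 2 / 2) by rewrite ler_pM2l //; lra.
  by lra.
have q1 : q * ((K + 1) * t) < q * q by rewrite ltr_pM2l.
have q2 : t * t < q * t by rewrite ltr_pM2r //; have := mulr_ge0 K0 (ltW t0); lra.
have := sqr_ge0 t; lra.
Qed.

Lemma hyp_near_inside v p (K e : R) : ldot v v = 1 -> 0 <= bend v -> uhs p ->
  - K <= ldot v (hyp p) -> 0 < e -> 4 * K * height p < e ->
  exists2 y, close e (proj p) y & 0 < ldot v (blift (pt y)).
Proof.
move=> v1 b0 hp vK e0 te; have h0 : 0 < height p by [].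
apply: near_inside => //; rewrite hyp_proj //.
have bt : 0 <= bend v * height p ^+ 2 by rewrite mulr_ge0 // sqr_ge0.
have l1 : height p * - K <= height p * ldot v (hyp p) by rewrite ler_pM2l.
lra.
Qed.

End Near.

(** * The orbit is an integral packing *)

Section Packing.
Context {R : realType} (N : nat).
Hypothesis N0 : (0 < N)%N.
Local Notation mirrors := (@mirrors R N).
Local Notation base := (@base R N).
Local Notation spheres := (@spheres R N).
Implicit Types (u v : lvec R) (x y : 'rV[R]_2) (p q : 'rV[R]_(2 + 1)).

Definition sphere_packing : set (oriented R 2) := [set lsphere v | v in spheres].

Lemma infinite_spheres (S : set (oriented R 2)) (F : lvec R -> R) :
  (forall M, exists v, [/\ spheres v, S (lsphere v) & M < F v]) -> infinite_set S.
Proof.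
move=> H /finite_seqP[s sE].
suff [M HM] : exists M, forall v, spheres v -> lsphere v \in s -> F v <= M.
  have [v [Pv Sv]] := H M; rewrite ltNge HM //.
  by move: Sv; rewrite sE.
elim: s {sE} => [|D s [M HM]]; first by exists 0.
have [[v0 [P0 v0D]]|nD] := pselect (exists v, spheres v /\ lsphere v = D).
  exists (Num.max (F v0) M) => v Pv; rewrite inE le_max => /predU1P[vD|/HM-> //].
    have -> : v = v0.
      by apply: lsphere_inj; [apply: spheres_unit Pv|apply: spheres_unit P0|rewrite vD].
    by rewrite lexx.
  by rewrite orbT.
exists M => v Pv; rewrite inE => /predU1P[vD|/HM-> //].
by case: nD; exists v.
Qed.

(** The reflections in the sides x = 0 and x = 2 compose to the translation by 4. *)
Lemma spheres_translates (k : nat) : spheres (circ (4 * k%:R) 0).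
Proof.
elim: k => [|k IH].
  by apply: base_spheres; apply: Or33; exists false, 0%N; rewrite !mulr0.
have -> : circ (4 * k.+1%:R : R) 0 = lact [:: LVec 0 4 1 0; LVec 0 0 (-1) 0] (circ (4 * k%:R) 0).
  by rewrite -(natr1 k); apply: lvec_eq; rewrite /= /lrefl /ldot /=; field.
apply: orbit_lact IH => a; rewrite !inE => /orP[/eqP->|/eqP->]; [exact: Or32|exact: Or31].
Qed.

Lemma sphere_packing_infinite : infinite_set sphere_packing.
Proof.
apply: (@infinite_spheres _ (@lx R)) => M.
exists (circ (4 * (Num.bound `|M|)%:R) 0); split; first exact: spheres_translates.
  by exists (circ (4 * (Num.bound `|M|)%:R) 0) => //; apply: spheres_translates.
have := archi_boundP (normr_ge0 M); have := ler_norm M => /=.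
by have := ler0n R (Num.bound `|M|); lra.
Qed.

Lemma circ_hyp (a b : R) p : uhs p -> 2 * height p * ldot (circ a b) (hyp p) =
  1 - (p 0 (lshift 1 0) - a) ^+ 2 - (p 0 (lshift 1 1) - b) ^+ 2 - height p ^+ 2.
Proof. by move=> hp; rewrite ldotZr /ldot /=; field; rewrite gt_eqF. Qed.

Lemma line_hyp (c d e : R) p : uhs p -> height p * ldot (LVec 0 c d e) (hyp p) =
  d * p 0 (lshift 1 0) + e * p 0 (lshift 1 1) - c / 2.
Proof. by move=> hp; rewrite ldotZr /ldot /=; field; rewrite gt_eqF. Qed.

(** The slack [d] is 0 for the polyhedron and the height of the point for its thickening. *)
Lemma row_choice (y d : R) : 0 <= d -> -1 - d <= y -> y <= 2 * N%:R - 1 + d ->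
  exists2 j : nat, (j < N)%N & `|y - 2 * j%:R| <= 1 + d.
Proof.
move=> d0 y1; elim: N N0 => [//|[|M] IH] _ yM.
  by exists 0%N => //; rewrite mulr0 subr0 ler_norml; apply/andP; split; lra.
have [y2|y2] := leP y (2 * M.+1%:R - 1 + d).
  by have [//|//|j jM jy] := IH; exists j => //; apply: leq_trans jM _.
exists M.+1 => //; rewrite -(natr1 M.+1) in yM.
by rewrite ler_norml; apply/andP; split; lra.
Qed.

Lemma column_choice (x : R) : 0 <= x <= 2 -> exists c : bool, `|x - 2 * c%:R| <= 1.
Proof.
move=> /andP[x0 x2]; have [x1|x1] := leP x 1.
  by exists false; rewrite mulr0 subr0 ler_norml; apply/andP; split; lra.
by exists true; rewrite mulr1 ler_norml; apply/andP; split; lra.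
Qed.

(* A point nearest to the base circle centered at [(2c, 2j)] has its nearest mirror
   centered at [(1, m)]. *)
Lemma mirror_choice (x y : R) (c : bool) (j : nat) : (j < N)%N -> 0 <= x <= 2 ->
  `|x - 2 * c%:R| <= 1 -> exists m : R, mirrors (circ 1 m) /\
  (x - 1) ^+ 2 = (1 - `|x - 2 * c%:R|) ^+ 2 /\
  (y - m) ^+ 2 = (1 - `|y - 2 * j%:R|) ^+ 2.
Proof.
move=> jN /andP[x0 x2] xc.
have ex : (x - 1) ^+ 2 = (1 - `|x - 2 * c%:R|) ^+ 2.
  case: c xc => /= _.
    by rewrite mulr1 ler0_norm ?subr_le0 //; ring.
  by rewrite mulr0 subr0 ger0_norm //; ring.
have [yj|yj] := leP 0 (y - 2 * j%:R).
  exists (2 * j.+1%:R - 1); split; first by apply: Or33; exists j.+1.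
  by split=> //; rewrite ger0_norm // -(natr1 j); ring.
exists (2 * j%:R - 1); split; first by apply: Or33; exists j => //; apply: ltnW.
by split=> //; rewrite ltr0_norm //; ring.
Qed.

(** Above height 1 the lower line is near enough. Below, with x' and y' the distances to the center
    of the nearest base circle, both at most 1, the nearest mirror gives x' + y' <= 1 + t^2, hence 1
    - x'^2 - y'^2 - t^2 >= - 2 t^2. *)
Lemma polyhedron_near_base p : uhs p ->
  (forall a, mirrors a -> ldot a (hyp p) <= 0) ->
  (forall b, base b -> ldot b (hyp p) <= 0) ->
  exists2 b, base b & - (2 * N%:R) <= ldot b (hyp p).
Proof.
move=> hp A0 B0; have h0 : 0 < height p by [].
have N1 : 1 <= (N%:R : R) by rewrite ler1n.
have sgn (c d e : R) : ldot (LVec 0 c d e) (hyp p) <= 0 ->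
    d * p 0 (lshift 1 0) + e * p 0 (lshift 1 1) - c / 2 <= 0.
  by move=> h; rewrite -line_hyp // mulr_ge0_le0 // ltW.
have x0 := sgn _ _ _ (A0 _ (Or31 _ _ erefl)).
have x2 := sgn _ _ _ (A0 _ (Or32 _ _ erefl)).
have y0 := sgn _ _ _ (B0 _ (@lower_base R N)).
have y1 := sgn _ _ _ (B0 _ (@upper_base R N)).
have cp := circ_hyp _ _ hp; have lp := line_hyp _ _ _ hp.
move: (p 0 (lshift 1 0)) (p 0 (lshift 1 1)) (height p) h0 x0 x2 y0 y1 cp lp {sgn} => x y t t0 x0 x2 y0 y1 cp lp.
have [t1|t1] := leP 1 t.
  exists lower_line; first exact: lower_base.
  rewrite -(ler_pM2l t0) lp; have : 0 <= (t - 1) * N%:R by apply: mulr_ge0; lra.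
  lra.
have [||j jN jy] := @row_choice y 0 (lexx _); [lra|lra|].
have xr : 0 <= x <= 2 by apply/andP; split; lra.
have [c cx] := column_choice xr.
exists (circ (2 * c%:R) (2 * j%:R)); first by apply: Or33; exists c, j.
have [m [Am [ex ey]]] := mirror_choice y jN xr cx.
have := A0 _ Am; rewrite -(ler_pM2l t0) mulr0 => am.
have := cp 1 m; rewrite ex ey => cm.
have := cp (2 * c%:R) (2 * j%:R).
rewrite -(real_normK (num_real (x - _))) -(real_normK (num_real (y - _))).
have x'0 := normr_ge0 (x - 2 * c%:R); have y'0 := normr_ge0 (y - 2 * j%:R).
move: `|x - 2 * c%:R| `|y - 2 * j%:R| x'0 y'0 cm cx jy {ex ey} => x' y' x'0 y'0 cm cx jy bE.
have d1 : 0 <= x' * (1 - x') by apply: mulr_ge0; lra.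
have d2 : 0 <= y' * (1 - y') by apply: mulr_ge0; lra.
have d3 : 0 <= t * (1 - t) by apply: mulr_ge0; lra.
have d4 : 0 <= t * (N%:R - 1) by apply: mulr_ge0; lra.
by rewrite -(ler_pM2l t0); lra.
Qed.

Lemma sphere_packing_inside_open B : oriented_sphere B ->
  exists x e, 0 < e /\ forall y, close e x y -> inside B (@pt R 2 y).
Proof.
case=> b [a r r0|a r r0|u c u0].
- exists a, (r / 2); split=> [|y [y0 y1]]; first by rewrite divr_gt0.
  exists y => //=; rewrite -(ltr_pXn2r (ltn0Sn 1)) ?nnegrE ?enorm_ge0 ?ltW //.
  rewrite enorm_sqr dot2 !mxE -!expr2.
  have := sqr_le_norm y0; have := sqr_le_norm y1; have := exprn_gt0 2 r0; lra.
- exists (row2 (a 0 0 + 2 * r) (a 0 1)), (r / 2); split=> [|y]; first by rewrite divr_gt0.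
  rewrite /close !mxE /= => -[]; rewrite ler_norml => /andP[y0 _] _; right; exists y => //=.
  rewrite -(ltr_pXn2r (ltn0Sn 1)) ?nnegrE ?enorm_ge0 ?ltW //.
  rewrite enorm_sqr dot2 !mxE -!expr2.
  have := sqr_ge0 (y 0 1 - a 0 1); nra.
- have d0 := dot_gt0 u0; set d := `|u 0 0| + `|u 0 1| + 1.
  have dp : 0 < d by rewrite ltr_wpDl // addr_ge0.
  have [q qE] : exists q : R, q * dot u u = c + 1.
    by exists ((c + 1) / dot u u); rewrite divfK // gt_eqF.
  exists (q *: u), d^-1; split=> [|y [y0 y1]]; first by rewrite invr_gt0.
  exists y => //=; rewrite !mxE in y0 y1.
  rewrite dot2 in qE; rewrite dot2.
  have L (z w : R) : `|w| <= d^-1 -> - (`|z| * d^-1) <= z * w.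
    by move=> h; rewrite lerNl (le_trans (ler_norm _)) // normrN normrM ler_wpM2l.
  have := L (u 0 0) _ y0; have := L (u 0 1) _ y1.
  have : (`|u 0 0| + `|u 0 1| + 1) * d^-1 = 1 by rewrite divff // gt_eqF.
  have : 0 < d^-1 by rewrite invr_gt0.
  move: d^-1 => k; lra.
Qed.

(** If [x] lies in no interior, a point [p] slightly above [x] is folded to a point of the
    polyhedron outside all base walls, hence near one of them. Unfolding gives a sphere whose
    interior comes within e of [x]. *)
Lemma sphere_packing_dense B : oriented_sphere B ->
  exists2 D, sphere_packing D & inside B `&` inside D !=set0.
Proof.
move=> /sphere_packing_inside_open[x [e [e0 Bx]]].
have [[v [Pv vx]]|out] := pselect (exists v, spheres v /\ 0 < ldot v (blift (pt x))).
  exists (lsphere v); first by exists v.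
  by exists (pt x); split=> //; apply: Bx; apply: closexx; apply: ltW.
(* The constant K = 2N of [polyhedron_near_base] requires 4 * 2N * t < e. *)
pose t := e / (16 * N%:R); have NR : 0 < (N%:R : R) by rewrite ltr0n.
have t0 : 0 < t by rewrite divr_gt0 // mulr_gt0.
pose p : 'rV[R]_(2 + 1) := row_mx x (const_mx t).
have ph : height p = t by rewrite /height row_mxEr mxE.
have hp : uhs p by rewrite /uhs /= ph.
have px : proj p = x by apply: row2P; rewrite mxE /= row_mxEl.
have [l [q [Al hq _ qE A0]]] := fold_uhs N0 hp.
have [b Bb|b Bb bN] := @polyhedron_near_base q hq A0.
  have Pv : spheres (lact (rev l) b).
    by apply: orbit_lact (base_spheres Bb) => a; rewrite mem_rev; apply: Al.
  rewrite qE -[l]revK -lact_sym.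
  rewrite -(pmulr_rle0 _ t0) -ph -[X in X <= _](addrK (bend (lact (rev l) b) * height p ^+ 2 / 2)).
  rewrite -hyp_proj // px subr_le0 (le_trans (_ : _ <= 0)) //.
    by rewrite leNgt; apply/negP => h; apply: out; exists (lact (rev l) b).
  by rewrite divr_ge0 // mulr_ge0 ?sqr_ge0 ?(spheres_bend_ge0 N0 Pv).
have Pv : spheres (lact (rev l) b).
  by apply: orbit_lact (base_spheres Bb) => a; rewrite mem_rev; apply: Al.
exists (lsphere (lact (rev l) b)); first by exists (lact (rev l) b).
rewrite qE -[l in lact l (hyp p)]revK -lact_sym in bN.
have [|y] := hyp_near_inside (spheres_unit Pv) (spheres_bend_ge0 N0 Pv) hp bN e0.
  by rewrite ph /t; have -> : 4 * (2 * N%:R) * (e / (16 * N%:R)) = e / 2; [field; rewrite gt_eqF|lra].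
by rewrite px => yx vy; exists (pt y); split => //; apply: Bx.
Qed.

Lemma sphere_packing_packing : packing sphere_packing.
Proof.
split.
- exact: sphere_packing_infinite.
- move=> _ [v Pv <-]; exists (bend v).
  exact: lsphere_has_bend (spheres_unit Pv) (spheres_bend_ge0 N0 Pv).
- move=> _ _ [v Pv <-] [w Pw <-] [z [vz wz]].
  by rewrite (spheres_separated N0 Pv Pw (blift_future z) vz wz).
- exact: sphere_packing_dense.
Qed.

Lemma sphere_packing_integral : integral_packing sphere_packing.
Proof.
move=> _ [v Pv <-]; have [/intrP[k kE] _ _ _] := spheres_int Pv.
exists k; rewrite -kE.
exact: lsphere_has_bend (spheres_unit Pv) (spheres_bend_ge0 N0 Pv).
Qed.

End Packing.

(** * The invariant of tangent pairs *)

Section Invariant.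
Context {R : realType}.
Implicit Types (u v w z : lvec R) (M N : nat).

Lemma tangent_pair_bound M v w : (0 < M)%N -> spheres M v -> spheres M w ->
  ldot v w = -1 ->
  exists z, [/\ spheres M z, z <> v, z <> w & - (2 * M%:R) <= ldot v z + ldot w z].
Proof.
move=> M0 Pv Pw /(orbit_tangent (@mirrors_unit R M) (@mirrors_dot R M)
  (@base_unit R M) (@base_dot R M) (@mirrors_base R M) Pv Pw)[l [b [b' [Al Bb Bb' vE wE]]]].
suff [z [Bz zb zb' zd]] : exists z, [/\ base M z, z <> b, z <> b' &
    - (2 * M%:R) <= ldot b z + ldot b' z].
  have lu := word_unit (@mirrors_unit R M) Al.
  exists (lact l z); split.
  - by apply: orbit_lact (base_spheres Bz).
  - by rewrite vE => e; apply: zb; rewrite -(lactK z lu) e lactK.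
  - by rewrite wE => e; apply: zb'; rewrite -(lactK z lu) e lactK.
  - by rewrite vE wE !lact_isom.
have M1 : 1 <= (M%:R : R) by rewrite ler1n.
have nc (c : bool) (j : nat) : lower_line <> circ (2 * c%:R) (2 * j%:R) :> lvec R.
  by move=> [/esym/eqP]; rewrite oner_eq0.
have nc' (c : bool) (j : nat) : upper_line M <> circ (2 * c%:R) (2 * j%:R) :> lvec R.
  by move=> [/esym/eqP]; rewrite oner_eq0.
have nl : lower_line <> upper_line M :> lvec R.
  by move=> [_] e; have := ltr0N1 R; rewrite e ltr01.
have D (c : bool) (j : nat) : (j < M)%N -> 0 <= (j%:R : R) <= M%:R - 1.
  by move=> jM; rewrite ler0n lerBrDr natr1 ler_nat.
have dl (c : bool) (j : nat) : ldot (circ (2 * c%:R) (2 * j%:R)) lower_line = - (2 * j%:R) - 1 :> R.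
  by rewrite /ldot /=; field.
have du (c : bool) (j : nat) : ldot (circ (2 * c%:R) (2 * j%:R)) (upper_line M) =
    2 * j%:R + 1 - 2 * M%:R :> R.
  by rewrite /ldot /=; field.
have lu : ldot lower_line (upper_line M) = -1 :> R by rewrite /ldot /=; field.
case: Bb Bb' => [->|->|[c [j [/(D c)/andP[j0 jM] ->]]]] [->|->|[c' [j' [/(D c')/andP[j0' jM'] ->]]]].
- exists (upper_line M); split; [exact: upper_base|exact: nesym|exact: nesym|rewrite lu; lra].
- exists (circ (2 * false%:R) (2 * 0%:R)); split.
  + by apply: Or33; exists false, 0%N.
  + exact: nesym (nc _ _).
  + exact: nesym (nc' _ _).
  + by rewrite ldotC dl (ldotC (upper_line M)) du; lra.
- exists (upper_line M); split; [exact: upper_base|exact: nesym|exact: nc'|].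
  by rewrite lu du; lra.
- exists (circ (2 * false%:R) (2 * 0%:R)); split.
  + by apply: Or33; exists false, 0%N.
  + exact: nesym (nc' _ _).
  + exact: nesym (nc _ _).
  + by rewrite ldotC du (ldotC lower_line) dl; lra.
- by exists lower_line; split=> //; [exact: lower_base|rewrite ldotC lu; lra].
- exists lower_line; split=> //; first exact: lower_base.
  by rewrite ldotC lu dl; lra.
- exists (upper_line M); split; [exact: upper_base|exact: nc'|exact: nesym|].
  by rewrite lu du; lra.
- exists lower_line; split=> //; first exact: lower_base.
  by rewrite dl ldotC lu; lra.
(* The lower line gives -2 (j + j' + 1) and the upper one 2 (j + j' + 1) - 4M; one of the two is at
   least -2M. *)
- have [jj|jj] := leP (j%:R + j'%:R + 1 : R) M%:R.
    exists lower_line; split=> //; first exact: lower_base.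
    by rewrite !dl; lra.
  exists (upper_line M); split; [exact: upper_base|exact: nc'|exact: nc'|].
  by rewrite !du; lra.
Qed.

Lemma lines_pair_bound N z : spheres N z -> z <> lower_line -> z <> upper_line N ->
  (0 < N)%N -> ldot lower_line z + ldot (upper_line N) z <= - (2 * N%:R).
Proof.
move=> Pz zl zu N0; rewrite dot_lines lerN2 ler_peMr // ?mulr_ge0 //.
by case: (spheres_bend N0 Pz).
Qed.

Lemma conformally_equivalent_spheres M N :
  conformally_equivalent (existT _ 2 (@sphere_packing R M)) (existT _ 2 (@sphere_packing R N)) ->
  exists phi : lvec R -> lvec R,
    [/\ forall u v, ldot (phi u) (phi v) = ldot u v,
        forall u, spheres M u -> spheres N (phi u) &
        forall v, spheres N v -> exists2 u, spheres M u & phi u = v].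
Proof.
case=> n [A [B [PE QE [f mf BE]]]].
have e : 2%N = n by have := congr1 (@projT1 _ _) PE.
subst n; have AE := eq_from_Tagged PE.
have BE' := eq_from_Tagged QE; subst A.
have [phi pi pl] := moebius_lsphere mf; exists phi.
split=> // [u Pu|v Pv].
  have : sphere_packing N (lsphere (phi u)).
    by rewrite BE' BE -pl; exists (lsphere u) => //; exists u.
  case=> v Pv vE; rewrite (@lsphere_inj _ (phi u) v) //; last exact: spheres_unit Pv.
  by rewrite pi; apply: spheres_unit Pu.
have : sphere_packing N (lsphere v) by exists v.
rewrite BE' BE => -[_ [u Pu <-]]; rewrite pl => e; exists u => //.
apply: lsphere_inj e; last exact: spheres_unit Pv.
by rewrite pi; apply: spheres_unit Pu.
Qed.

(** For K < L, the pair of spheres of the packing K that corresponds to the two lines of the packing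
    L has a third sphere with total product at least -2K; in the packing L every third sphere gives
    at most -2L. *)
Lemma sphere_packings_inequivalent M N : (0 < M)%N -> (0 < N)%N -> M <> N ->
  ~ conformally_equivalent (existT _ 2 (@sphere_packing R M)) (existT _ 2 (@sphere_packing R N)).
Proof.
(* A relation in place of a map lets [phi] be read in either direction, according to which index is
   smaller. *)
have key (K L : nat) : (0 < K)%N -> (K < L)%N -> forall rho : lvec R -> lvec R -> Prop,
    (forall u v u' v', spheres K u -> spheres K v -> rho u u' -> rho v v' -> ldot u' v' = ldot u v) ->
    (forall u', spheres L u' -> exists2 u, spheres K u & rho u u') ->
    (forall u, spheres K u -> exists2 u', spheres L u' & rho u u') -> False.
  move=> K0 KL rho iso surj tot; have L0 : (0 < L)%N by apply: leq_ltn_trans KL.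
  have [u Pu ru] := surj _ (base_spheres (@lower_base R L)).
  have [v Pv rv] := surj _ (base_spheres (@upper_base R L)).
  have uv : ldot u v = -1 by rewrite -(iso _ _ _ _ Pu Pv ru rv) /ldot /=; field.
  have [z [Pz zu zv zb]] := tangent_pair_bound K0 Pu Pv uv.
  have [z' Pz' rz] := tot _ Pz.
  have ne (w w' : lvec R) : spheres K w -> rho w w' -> z <> w -> z' <> w'.
    move=> Pw rw zw zE; have := spheres_dot Pz Pw zw.
    rewrite -(iso _ _ _ _ Pz Pw rz rw) -zE (spheres_unit Pz').
    by rewrite leNgt (lt_trans (ltrN10 R) ltr01).
  have := lines_pair_bound Pz' (ne _ _ Pu ru zu) (ne _ _ Pv rv zv) L0.
  rewrite (iso _ _ _ _ Pu Pz ru rz) (iso _ _ _ _ Pv Pz rv rz).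
  have : (K%:R + 1 : R) <= L%:R by rewrite natr1 ler_nat.
  lra.
move=> M0 N0 MN /conformally_equivalent_spheres[phi [pi pt ps]].
have [lt|gt|//] := ltngtP M N.
- apply: (key M N M0 lt (fun u v => phi u = v)) => [u v _ _ _ _ <- <-|//|u Pu].
    exact: pi.
  by exists (phi u) => //; apply: pt.
- apply: (key N M N0 gt (fun v u => phi u = v)) => [_ _ u v _ _ <- <-|u Pu|].
  + by rewrite pi.
  + by exists (phi u) => //; apply: pt.
  + by [].
Qed.

End Invariant.

(** * Neighborhoods and convergence in the one-point compactification *)

Section Topology.
Context {R : realType} {m : nat}.
Implicit Types x y : 'rV[R]_m.

Lemma nbhs_ptP x (U : set (Rhat R m)) : nbhs (pt x) U <->
  exists2 e, 0 < e & forall y, (forall i, `|y 0 i - x 0 i| < e) -> U (pt y).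
Proof.
rewrite /nbhs /= /one_point_nbhs /=; split=> [/nbhs_ballP[e /= e0 H]|[e e0 H]].
  exists e => // y yx; apply: H; split=> // i j.
  by rewrite (ord1 i) /ball /= distrC.
apply/nbhs_ballP; exists e => //= y [_ yx]; apply: H => i.
by have := yx 0 i; rewrite /ball /= distrC.
Qed.

Lemma nbhs_infty (U : set (Rhat R m)) : nbhs (infty : Rhat R m) U ->
  exists M, forall y i, M < `|y 0 i| -> U (pt y).
Proof.
rewrite /nbhs /= => -[K [/compact_bounded [M [_ HM]] _] KU].
exists (M + 1) => y i yM; apply: KU; left; exists y => //= Ky.
have M1 : M < M + 1 by rewrite ltrDl.
have yn : `|y| <= M + 1 := HM _ M1 _ Ky.
move: yM; rewrite ltNge => /negP; apply; apply: le_trans yn.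
by rewrite [leRHS]/Num.Def.normr /= mx_normrE; apply/bigmax_geP; right; exists (0, i).
Qed.

Lemma cvg_ptP x (q : nat -> 'rV[R]_m) : (fun k => pt (q k)) @ \oo --> pt x <->
  forall e, 0 < e -> exists K, forall k, (K <= k)%N -> forall i, `|q k 0 i - x 0 i| < e.
Proof.
split=> [cv e e0|H U /nbhs_ptP[e e0 HU]].
  have /cv [K _ HK] : nbhs (pt x) [set z | exists2 y, z = pt y & forall i, `|y 0 i - x 0 i| < e].
    by apply/nbhs_ptP; exists e => // y yx; exists y.
  by exists K => k /HK [y [->]].
by have [K HK] := H _ e0; exists K => // k /HK/HU.
Qed.

End Topology.

(** * Equality of the two limit sets *)

Section LimitSet.
Context {R : realType} (N : nat).
Hypothesis N0 : (0 < N)%N.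
Local Notation mirrors := (@mirrors R N).
Local Notation base := (@base R N).
Local Notation spheres := (@spheres R N).
Local Notation sphere_packing := (@sphere_packing R N).
Local Notation refl_group := (@refl_group R N).
Implicit Types (u v : lvec R) (x y : 'rV[R]_2) (p q : 'rV[R]_(2 + 1)).

Lemma packing_limit_infty : packing_limit_set sphere_packing infty.
Proof.
move=> U /nbhs_infty[M HM]; apply: (@infinite_spheres _ N _ (@lx R)) => L.
set n := Num.bound (`|M| + `|L|); exists (circ (4 * n%:R) 0).
have Pv : spheres (circ (4 * n%:R) 0) by exact: spheres_translates.
split=> //; last first.
  rewrite /=; have := archi_boundP (addr_ge0 (normr_ge0 M) (normr_ge0 L)).
  by have := ler_norm L; have := normr_ge0 M; have := ler0n R n; rewrite -/n; lra.
split; first by exists (circ (4 * n%:R) 0).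
exists (pt (row2 (4 * n%:R + 1) 0)); split.
  by rewrite /= /ldot /= !mxE /=; field.
apply: (HM _ 0); rewrite row2E0 ger0_norm ?addr_ge0 ?mulr_ge0 //.
have := archi_boundP (addr_ge0 (normr_ge0 M) (normr_ge0 L)).
by have := ler_norm M; have := normr_ge0 L; have := ler0n R n; rewrite -/n; lra.
Qed.

Lemma hyp_coord p : uhs p -> p 0 (lshift 1 0) * bend (hyp p) = lx (hyp p).
Proof. by move=> hp; rewrite /= mulr1 mulrC. Qed.

Lemma group_limit_infty : group_limit_set refl_group infty.
Proof.
have step (k : nat) : exists gq : (Rhat R (2 + 1) -> Rhat R (2 + 1)) * 'rV[R]_(2 + 1),
    [/\ refl_group gq.1, uhs gq.2, gq.1 (pt (basept N)) = pt gq.2 &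
        gq.2 0 (lshift 1 0) = 1 + 4 * k%:R].
  elim: k => [|k [[g q] /= [Gg hq gq qk]]].
    exists (id, basept N); split=> //=; [exact: gen_group_id|exact: uhs_basept|].
    by rewrite row_mxEl mxE /= mulr0 addr0.
  have Al a : a \in [:: LVec 0 4 1 0; LVec 0 0 (-1) 0] -> mirrors a.
    by rewrite !inE => /orP[/eqP->|/eqP->]; [exact: Or32|exact: Or31].
  have [q' [hq' e1 e2]] := hact_hyp Al hq.
  exists (hact [:: LVec 0 4 1 0; LVec 0 0 (-1) 0] \o g, q'); split=> //=.
  - by apply: gen_group_comp => //; apply/refl_groupP; eexists; first exact: Al.
  - by rewrite gq.
  have b0 : bend (hyp q) != 0 by rewrite /= mulr1 invr_neq0 // gt_eqF.
  have c := hyp_coord hq; have c' := hyp_coord hq'.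
  have be : bend (hyp q') = bend (hyp q) by rewrite e2 /= /lrefl /ldot /=; field; rewrite gt_eqF.
  have le : lx (hyp q') = lx (hyp q) + 4 * bend (hyp q).
    by rewrite e2 /= /lrefl /ldot /=; field; rewrite gt_eqF.
  apply: (mulIf b0); rewrite -{1}be c' le -c qk -(natr1 k); ring.
pose gq k := projT1 (cid (step k)).
have G k := projT2 (cid (step k)); rewrite -/(gq _) in G.
exists (basept N), (fun k => (gq k).1); split; first exact: uhs_basept.
  by move=> k; have [] := G k.
move=> U /nbhs_infty[M HM]; exists (Num.bound `|M|) => // k /= Mk.
have [_ _ -> qk] := G k; apply: (HM _ (lshift 1 0)); rewrite qk.
rewrite ger0_norm ?addr_ge0 ?mulr_ge0 //.
have kb : (Num.bound `|M|)%:R <= k%:R :> R by rewrite ler_nat.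
have := archi_boundP (normr_ge0 M); have := ler_norm M; have := ler0n R k.
lra.
Qed.

(** At most one sphere of the packing has a positive product with [hyp p]. *)
Lemma spheres_hyp_bounded p : uhs p ->
  exists2 K, 0 <= K & forall w, spheres w -> ldot w (hyp p) <= K.
Proof.
move=> hp; have [[w [Pw wp]]|H] := pselect (exists w, spheres w /\ 0 < ldot w (hyp p)).
  exists (ldot w (hyp p)) => [|v Pv]; first exact: ltW.
  have [vp|vp] := leP (ldot v (hyp p)) 0; first by rewrite (le_trans vp) // ltW.
  by rewrite (spheres_separated N0 Pv Pw (hyp_future hp) vp wp).
exists 0 => // w Pw; rewrite leNgt; apply/negP => wp.
by apply: H; exists w.
Qed.

Lemma limit_sequence x p (g : nat -> Rhat R (2 + 1) -> Rhat R (2 + 1)) :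
  uhs p -> (forall k, refl_group (g k)) ->
  (fun k => g k (pt p)) @ \oo --> ideal (pt x) ->
  forall e, 0 < e -> exists l q, [/\ forall a, a \in l -> mirrors a, uhs q,
    hyp q = lact l (hyp p), close e x (proj q) & height q < e].
Proof.
move=> hp Gg; have step k : exists lq : seq (lvec R) * 'rV[R]_(2 + 1),
    [/\ forall a, a \in lq.1 -> mirrors a, uhs lq.2, g k (pt p) = pt lq.2 &
        hyp lq.2 = lact lq.1 (hyp p)].
  have /refl_groupP[l Al gl] := Gg k; have [q [hq e1 e2]] := hact_hyp Al hp.
  by exists (l, q); rewrite gl.
pose lq k := projT1 (cid (step k)).
have G k := projT2 (cid (step k)); rewrite -/(lq _) in G.
have -> : (fun k => g k (pt p)) = (fun k => pt (lq k).2).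
  by apply/funext => k; have [] := G k.
move=> /cvg_ptP cv e e0; have [K HK] := cv e e0.
have [Al hq _ qE] := G K; exists (lq K).1, (lq K).2; split=> //.
  split; rewrite mxE /=; have := HK K (leqnn _).
    by move=> /(_ (lshift 1 0)); rewrite row_mxEl => /ltW.
  by move=> /(_ (lshift 1 1)); rewrite row_mxEl => /ltW.
have := HK K (leqnn _) (rshift 2 0); rewrite row_mxEr mxE subr0 -/(height _).
by rewrite gtr0_norm.
Qed.

(** If translates [q] of [p] approached a point inside [v], the product of [v] with [hyp q] would
    blow up like the inverse of the height. It equals the product of [hyp p] with another sphere of
    the packing, which is bounded. *)
Lemma group_limit_outside z v : group_limit_set refl_group z -> spheres v ->
  ldot v (blift z) <= 0.
Proof.
move=> + Pv; case: z => [x|_]; last first.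
  by rewrite /ldot /=; have := spheres_bend_ge0 N0 Pv; lra.
move=> [p [g [hp Gg cv]]]; rewrite leNgt; apply/negP => vx.
have [K K0 HK] := spheres_hyp_bounded hp.
have b0 := spheres_bend_ge0 N0 Pv.
set c := ldot v (blift _) in vx.
(* [d * S] dominates the variation of the equation of [v] from [x] to [proj q] together with the two
   other terms of [hyp_proj]. *)
pose S := `|gradx v x| + `|grady v x| + 2 * bend v + K + 1.
have S0 : 0 < S by rewrite ltr_wpDl // !addr_ge0 // mulr_ge0.
pose d := Num.min 1 (c / S).
have d0 : 0 < d by rewrite lt_min ltr01 divr_gt0.
have [l [q [Al hq qE [q1 q2] qd]]] := limit_sequence hp Gg cv d0.
have h0 : 0 < height q by [].
have d1 : d <= 1 by rewrite ge_min lexx.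
have dS : d * S <= c by rewrite -ler_pdivlMr // ge_min lexx orbT.
have Pw : spheres (lact (rev l) v).
  by apply: orbit_lact Pv => a; rewrite mem_rev; apply: Al.
have := HK _ Pw; rewrite lact_sym revK -qE -(ler_pM2l h0) => hK.
have := hyp_proj v hq.
have -> : proj q = row2 (x 0 0 + (proj q 0 0 - x 0 0)) (x 0 1 + (proj q 0 1 - x 0 1)).
  by apply: row2P; rewrite [RHS]mxE /=; ring.
rewrite blift_shift -/c.
move: (proj q 0 0 - x 0 0) (proj q 0 1 - x 0 1) q1 q2 => s t sd td.
have L (r w : R) : `|r| <= d -> - (d * `|w|) <= r * w.
  by move=> rd; rewrite lerNl (le_trans (ler_norm _)) // normrN normrM ler_wpM2r.
have := L s (gradx v x) sd; have := L t (grady v x) td.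
have d2 : d ^+ 2 <= d by rewrite expr2 ger_pMr.
have bd (r : R) : `|r| <= d -> bend v * r ^+ 2 <= bend v * d.
  move=> rd; rewrite ler_wpM2l // (le_trans _ d2) //; exact: sqr_le_norm.
have := bd s sd; have := bd t td; have := bd (height q).
rewrite gtr0_norm // => /(_ (ltW qd)).
have : height q * K <= d * K by rewrite ler_wpM2r // ltW.
have dE : d * S = d * `|gradx v x| + d * `|grady v x| + 2 * (bend v * d) + d * K + d.
  by rewrite /S; ring.
have bd0 : 0 <= bend v * d by rewrite mulr_ge0 // ltW.
rewrite dE in dS; lra.
Qed.

(** By completing squares, [2 * bend u * height q * ldot u (hyp q)] is [- kap] minus three squares.
    Thus, for a fixed K, the bend is large when [q] is low. *)
Lemma timelike_bend u q (K kap : R) : uhs q -> 0 <= bend u -> ldot u u = - kap ->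
  - K <= ldot u (hyp q) -> kap <= 2 * K * height q * bend u.
Proof.
move=> hq b0 uu uq; have h0 : 0 < height q by [].
have E : 2 * bend u * (height q * ldot u (hyp q)) = - kap -
    (lx u - bend u * q 0 (lshift 1 0)) ^+ 2 - (ly u - bend u * q 0 (lshift 1 1)) ^+ 2 -
    (bend u * height q) ^+ 2.
  by rewrite -uu ldotZr /ldot /=; field; rewrite gt_eqF.
have := sqr_ge0 (lx u - bend u * q 0 (lshift 1 0)).
have := sqr_ge0 (ly u - bend u * q 0 (lshift 1 1)).
have := sqr_ge0 (bend u * height q).
have : 2 * bend u * (height q * - K) <= 2 * bend u * (height q * ldot u (hyp q)).
  by rewrite ler_wpM2l ?mulr_ge0 // ler_pM2l.
lra.
Qed.

(** Translates of a single base wall may keep a bounded bend, for instance if the words fix it. The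
    sum [T] of three base walls is timelike, of square 1 - 4N, so its translates have unbounded
    bend, and so does one of the three walls each time; all three pass near [x]. *)
Lemma group_limit_packing_limit z : group_limit_set refl_group z ->
  packing_limit_set sphere_packing z.
Proof.
case: z => [x|_]; last exact: packing_limit_infty.
move=> [p [g [hp Gg cv]]] U /nbhs_ptP[e e0 HU].
apply: (@infinite_spheres _ N _ (@bend R)) => M.
pose b3 : lvec R := circ (2 * false%:R) (2 * 0%:R).
have B3 : base b3 by apply: Or33; exists false, 0%N.
pose T := ladd (ladd lower_line (upper_line N)) b3.
pose K := `|ldot lower_line (hyp p)| + `|ldot (upper_line N) (hyp p)| + `|ldot b3 (hyp p)|.
have K0 : 0 <= K by rewrite !addr_ge0.
pose kap := (4 * N%:R - 1 : R).
have N1 : 1 <= (N%:R : R) by rewrite ler1n.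
have kap0 : 0 < kap by rewrite /kap; lra.
(* The second bound places the three carriers within e / 4 of [proj q], the third one makes the bend
   of the translate of [T] exceed 3 |M|. *)
pose d := Num.min (e / 2) (Num.min (e / (32 * (K + 1))) (kap / (2 * (K + 1) * (3 * `|M| + 1)))).
have d0 : 0 < d.
  have K1 : 0 < K + 1 by rewrite ltr_wpDl.
  have M1 : 0 < 3 * `|M| + 1 by rewrite ltr_wpDl // mulr_ge0.
  by rewrite !lt_min; apply/and3P; split; rewrite !(divr_gt0, mulr_gt0).
have [l [q [Al hq qE [q1 q2] qd]]] := limit_sequence hp Gg cv d0.
have h0 : 0 < height q by [].
have hd1 : 8 * (K + 1) * height q < e / 4.
  have : height q < e / (32 * (K + 1)).
    by apply: lt_le_trans qd _; rewrite !ge_min lexx orbT.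
  by rewrite ltr_pdivlMr; [lra|rewrite mulr_gt0 // ltr_wpDl].
have meets b : base b -> `|ldot b (hyp p)| <= K -> carrier (lsphere (lact l b)) `&` U !=set0.
  move=> Bb bK; have Pv := orbit_lact Al (base_spheres Bb).
  have [|y [y1 y2] vy] := hyp_near_carrier (spheres_unit Pv) (spheres_bend_ge0 N0 Pv) hq _ hd1.
    by rewrite qE lact_isom // => a /Al/mirrors_unit.
  exists (pt y); split=> //; apply: HU => i.
  have de : d <= e / 2 by rewrite ge_min lexx.
  have L (a b' c : R) : `|b' - a| <= d -> `|c - b'| <= e / 4 -> `|c - a| < e.
    rewrite ler_norml => /andP[? ?]; rewrite ler_norml ltr_norml => /andP[? ?].
    by apply/andP; split; lra.
  case: i => -[|[|//]] i.
    by rewrite (_ : Ordinal i = 0); [apply: L q1 y1|apply: val_inj].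
  by rewrite (_ : Ordinal i = 1); [apply: L q2 y2|apply: val_inj].
have Kb : [/\ `|ldot lower_line (hyp p)| <= K, `|ldot (upper_line N) (hyp p)| <= K &
    `|ldot b3 (hyp p)| <= K].
  have := normr_ge0 (ldot lower_line (hyp p)); have := normr_ge0 (ldot b3 (hyp p)).
  have := normr_ge0 (ldot (upper_line N) (hyp p)); rewrite /K.
  by split; lra.
case: Kb => k1 k2 k3.
have P1 := orbit_lact Al (base_spheres (@lower_base R N)).
have P2 := orbit_lact Al (base_spheres (@upper_base R N)).
have P3 := orbit_lact Al (base_spheres B3).
have S1 := spheres_bend_ge0 N0 P1; have S2 := spheres_bend_ge0 N0 P2.
have S3 := spheres_bend_ge0 N0 P3.
have bT : bend (lact l T) = bend (lact l lower_line) + bend (lact l (upper_line N)) +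
    bend (lact l b3) by rewrite /T !lactD.
have TT : ldot (lact l T) (lact l T) = - kap.
  by rewrite lact_isom => [|a /Al/mirrors_unit//]; rewrite /T /kap /ldot /=; field.
have Tq : - K <= ldot (lact l T) (hyp q).
  rewrite qE lact_isom => [|a /Al/mirrors_unit//]; rewrite /T !ldotDl /K.
  have L (r : R) : - `|r| <= r by rewrite lerNl (le_trans (ler_norm _)) // normrN.
  have := L (ldot lower_line (hyp p)); have := L (ldot (upper_line N) (hyp p)).
  by have := L (ldot b3 (hyp p)); lra.
have bT0 : 0 <= bend (lact l T) by rewrite bT !addr_ge0.
have h1 := timelike_bend hq bT0 TT Tq.
have M0 := normr_ge0 M; have MM := ler_norm M.
have h2 : height q * (2 * (K + 1) * (3 * `|M| + 1)) < kap.
  rewrite -ltr_pdivlMr ?mulr_gt0 // ?ltr_wpDl ?mulr_ge0 //.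
  by apply: lt_le_trans qd _; rewrite !ge_min lexx !orbT.
have big : 3 * `|M| < bend (lact l T).
  rewrite ltNge; apply/negP => h3.
  have h4 : 2 * K * height q * bend (lact l T) <= 2 * K * height q * (3 * `|M|).
    by rewrite ler_wpM2l // !mulr_ge0 // ltW.
  have h5 : 0 <= height q * `|M| by rewrite mulr_ge0 // ltW.
  have h6 : 0 <= height q * K by rewrite mulr_ge0 // ltW.
  lra.
have [l1|l1] := ltP M (bend (lact l lower_line)).
  by exists (lact l lower_line); split=> //; split; [exists (lact l lower_line)|apply: meets (@lower_base R N) k1].
have [l2|l2] := ltP M (bend (lact l (upper_line N))).
  by exists (lact l (upper_line N)); split=> //; split; [exists (lact l (upper_line N))|apply: meets (@upper_base R N) k2].
exists (lact l b3); split=> //; last by rewrite bT in big; lra.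
by split; [exists (lact l b3)|apply: meets B3 k3].
Qed.

Lemma base_basept_bound b : base b ->
  `|ldot b (hyp (basept N))| <= 2 * N%:R ^+ 2 + 2 * N%:R + 1.
Proof.
move=> Bb; have s0 := @sqrt2N_gt0 R N N0; set s := Num.sqrt _ in s0.
have N1 : 1 <= (N%:R : R) by rewrite ler1n.
have s1 : s^-1 <= 1.
  by rewrite invf_le1 // -[1]sqrtr1 ler_wsqrtr // (le_trans N1) // ler_peMl // ler1n.
rewrite hyp_basept // ldotZr normrM (ger0_norm (_ : 0 <= s^-1)) ?invr_ge0 ?(ltW s0) //.
apply: (@le_trans _ _ `|ldot b (base_lvec N)|).
  by rewrite ler_piMl.
have N2 := sqr_ge0 (N%:R : R).
case: Bb => [->|->|[c [j [jN ->]]]]; rewrite ler_norml /ldot /=.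
- by apply/andP; split; lra.
- by apply/andP; split; lra.
- have j0 := ler0n R j; have j1 : (j%:R : R) <= N%:R by rewrite ler_nat ltnW.
  have jj : (j%:R : R) ^+ 2 <= N%:R ^+ 2 by rewrite ler_pXn2r ?nnegrE.
  have := sqr_ge0 (j%:R : R).
  by case: c => /=; move=> ?; apply/andP; split; lra.
Qed.

(** By integrality, only finitely many spheres of bounded bend meet a bounded region: on the carrier
    the gradient of norm 1 bounds [lx] and [ly], and the equation of the sphere then bounds
    [cobend]. *)
Lemma packing_limit_sphere x (k : nat) : packing_limit_set sphere_packing (pt x) ->
  exists v y, [/\ spheres v, k.+1%:R < bend v, ldot v (blift (pt y)) = 0 &
    close k.+1%:R^-1 x y].
Proof.
move=> lim; have k0 : 0 < k.+1%:R^-1 :> R by rewrite invr_gt0 ltr0n.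
pose U : set (Rhat R 2) := [set z | exists2 y, z = pt y & close k.+1%:R^-1 x y].
have nU : nbhs (pt x) U.
  apply/nbhs_ptP; exists k.+1%:R^-1 => // y yx; exists y => //.
  by split; apply: ltW; apply: yx.
apply: contrapT => H; apply: lim nU _.
pose r := `|x 0 0| + `|x 0 1| + 1.
have r1 : 1 <= r by rewrite lerDr addr_ge0.
pose b : R := k.+1%:R.
have b0 : 0 <= b by rewrite ler0n.
pose M := 1 + b * r + 4 * (1 + b * r) * r + 2 * b * r ^+ 2 + b.
apply: sub_finite_set (finite_image (@lsphere R) (finite_int_lvec M)).
move=> _ [[v Pv <-] [z [vy [y zE [y0 y1]]]]]; exists v => //; subst z.
split; first exact: spheres_int Pv.
have vb : 0 <= bend v <= b.
  rewrite (spheres_bend_ge0 N0 Pv) leNgt; apply/negP => vb.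
  by apply: H; exists v, y; split.
have k1 : k.+1%:R^-1 <= 1 :> R by rewrite invf_le1 ?ltr0n // ler1n.
have yr (s w : R) : `|w - s| <= k.+1%:R^-1 -> `|s| <= r - 1 -> `|w| <= r.
  move=> h1 h2; have -> : w = s + (w - s) by ring.
  rewrite (le_trans (ler_normD _ _)) // (le_trans (lerD h2 (le_trans h1 k1))) //.
  by rewrite subrK.
have {}y0 : `|y 0 0| <= r by apply: yr y0 _; rewrite /r addrK lerDl.
have {}y1 : `|y 0 1| <= r by apply: yr y1 _; rewrite /r addrK lerDr.
have := grad_norm y (spheres_unit Pv); have {}vy : ldot v (blift (pt y)) = 0 by [].
rewrite vy mulr0 subr0 => G.
have gl (l' w : R) : (l' - bend v * w) ^+ 2 <= 1 -> `|w| <= r -> `|l'| <= 1 + b * r.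
  move=> h1 wr; have -> : l' = (l' - bend v * w) + bend v * w by ring.
  rewrite (le_trans (ler_normD _ _)) // lerD //.
    by rewrite -(ler_pXn2r (ltn0Sn 1)) ?nnegrE // real_normK ?num_real // expr1n.
  by move/andP: vb => [v0 v1]; rewrite normrM (ger0_norm v0) ler_pM.
have lx1 : `|lx v| <= 1 + b * r.
  by apply: gl y0; rewrite -G lerDl sqr_ge0.
have ly1 : `|ly v| <= 1 + b * r.
  by apply: gl y1; rewrite -G lerDr sqr_ge0.
have br : 0 <= b * r by rewrite mulr_ge0 // (le_trans ler01).
have p1 : `|lx v * y 0 0| <= (1 + b * r) * r by rewrite normrM ler_pM.
have p2 : `|ly v * y 0 1| <= (1 + b * r) * r by rewrite normrM ler_pM.
have ys (w : R) : `|w| <= r -> 0 <= bend v * w ^+ 2 <= b * r ^+ 2.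
  move/andP: vb => [v0 v1] wr; rewrite mulr_ge0 ?sqr_ge0 //=.
  by rewrite ler_pM ?sqr_ge0 // sqr_le_norm.
have /andP[s1 s2] := ys _ y0; have /andP[s3 s4] := ys _ y1.
have t1 : 0 <= (1 + b * r) * r.
  by rewrite mulr_ge0 ?addr_ge0 // (le_trans ler01).
have t2 : 0 <= b * r ^+ 2 by rewrite mulr_ge0 // sqr_ge0.
move: vb => /andP[v0 v1].
split; rewrite /M.
- by rewrite ger0_norm //; lra.
- have -> : cobend v = 2 * (lx v * y 0 0 + ly v * y 0 1) -
      bend v * y 0 0 ^+ 2 - bend v * y 0 1 ^+ 2.
    by move: vy; rewrite /ldot /=; lra.
  move: p1 p2; rewrite !ler_norml => /andP[? ?] /andP[? ?].
  by apply/andP; split; lra.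
- lra.
- lra.
Qed.

(** With a = bend * height, the gradient at [proj q] gives a^2 <= 1 + 2 a K, so a <= 2K + 1. The
    displacement from [y] to [proj q], times the bend, is a difference of two bounded gradients. *)
Lemma hyp_near_small v q y (K : R) : ldot v v = 1 -> 0 < bend v -> uhs q ->
  `|ldot v (hyp q)| <= K -> ldot v (blift (pt y)) = 0 ->
  close ((2 * K + 2) / bend v) y (proj q) /\ height q <= (2 * K + 1) / bend v.
Proof.
move=> v1 b0 hq vK vy; have h0 : 0 < height q by [].
have K0 : 0 <= K by apply: le_trans vK.
have G := grad_norm (proj q) v1; rewrite hyp_proj // in G.
have := grad_norm y v1; rewrite vy mulr0 subr0 => Gy.
pose a := bend v * height q; have a0 : 0 < a by rewrite mulr_gt0.
have aK : - (a * K) <= a * ldot v (hyp q).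
  by rewrite -mulrN ler_pM2l // lerNl (le_trans (ler_norm _)) // normrN.
have {}G : gradx v (proj q) ^+ 2 + grady v (proj q) ^+ 2 + a ^+ 2 <= 1 + 2 * (a * K).
  by rewrite G /a in aK *; lra.
have x0 := sqr_ge0 (gradx v (proj q)); have y0 := sqr_ge0 (grady v (proj q)).
have aL : a <= 2 * K + 1.
  rewrite leNgt; apply/negP => aL.
  have : a * (2 * K + 1) < a * a by rewrite ltr_pM2l.
  by have : 1 < a; [lra|]; have := mulr_ge0 (ltW a0) K0; lra.
have aKL : a * K <= (2 * K + 1) * K by rewrite ler_wpM2r.
have L (r s : R) : r ^+ 2 <= (2 * K + 1) ^+ 2 -> s ^+ 2 <= 1 ->
    `|s - r| <= 2 * K + 2.
  move=> h1 h2; have K1 : 0 <= 2 * K + 1 by lra.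
  have : `|r| <= 2 * K + 1.
    by rewrite -(ler_pXn2r (ltn0Sn 1)) ?nnegrE // real_normK ?num_real.
  have : `|s| <= 1.
    by rewrite -(ler_pXn2r (ltn0Sn 1)) ?nnegrE // real_normK ?num_real // expr1n.
  by rewrite !ler_norml => /andP[? ?] /andP[? ?]; apply/andP; split; lra.
have KK := sqr_ge0 K; have aa := sqr_ge0 a.
split; last by rewrite ler_pdivlMr // mulrC.
have gx0 := sqr_ge0 (gradx v y); have gy0 := sqr_ge0 (grady v y).
split; rewrite ler_pdivlMr // -[X in _ * X <= _](gtr0_norm b0) -normrM.
- have -> : (proj q 0 0 - y 0 0) * bend v = gradx v y - gradx v (proj q).
    by rewrite /gradx; ring.
  by apply: L; lra.
- have -> : (proj q 0 1 - y 0 1) * bend v = grady v y - grady v (proj q).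
    by rewrite /grady; ring.
  by apply: L; lra.
Qed.

(** A sphere of large bend near [x] is a translate of a base wall, and the same word sends [basept]
    to a point at bounded product with it, hence close to [x]. *)
Lemma packing_limit_group_limit z : packing_limit_set sphere_packing z ->
  group_limit_set refl_group z.
Proof.
case: z => [x lim|_]; last exact: group_limit_infty.
pose K := 2 * N%:R ^+ 2 + 2 * N%:R + 1 : R.
have K0 : 0 <= K by rewrite !addr_ge0 // mulr_ge0 // sqr_ge0.
(* 2K + 2 from [hyp_near_small], and 1 for the distance from the sphere to [x]. *)
pose C := 2 * K + 3; have C0 : 0 < C by rewrite ltr_wpDl // mulr_ge0.
have step (k : nat) : exists gq : (Rhat R (2 + 1) -> Rhat R (2 + 1)) * 'rV[R]_(2 + 1),
    [/\ refl_group gq.1, gq.1 (pt (basept N)) = pt gq.2 &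
        forall i, `|gq.2 0 i - row_mx x (0 : 'rV[R]_1) 0 i| <= C / k.+1%:R].
  have [v [y [Pv vk vy [y0 y1]]]] := packing_limit_sphere k lim.
  have k0 : 0 < k.+1%:R :> R by rewrite ltr0n.
  have b0 : 0 < bend v by apply: lt_trans vk.
  have bk : (bend v)^-1 <= k.+1%:R^-1 by rewrite lef_pV2 ?posrE // ltW.
  have [l [b [Al Bb vE]]] := Pv; have [q [hq e1 e2]] := hact_hyp Al (uhs_basept N0).
  have qK : `|ldot v (hyp q)| <= K.
    rewrite vE e2 lact_isom => [|a /Al/mirrors_unit//].
    exact: base_basept_bound.
  have [[c0 c1] c2] := hyp_near_small (spheres_unit Pv) b0 hq qK vy.
  have c3 : (2 * K + 2) / bend v <= (2 * K + 2) / k.+1%:R.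
    by rewrite ler_wpM2l // addr_ge0 // mulr_ge0.
  have c4 : (2 * K + 1) / bend v <= (2 * K + 1) / k.+1%:R.
    by rewrite ler_wpM2l // addr_ge0 // mulr_ge0.
  have CE : C / k.+1%:R = (2 * K + 2) / k.+1%:R + k.+1%:R^-1 by rewrite /C; field; rewrite gt_eqF.
  have CE' : C / k.+1%:R = (2 * K + 1) / k.+1%:R + 2 * k.+1%:R^-1 by rewrite /C; field; rewrite gt_eqF.
  have ki : 0 < k.+1%:R^-1 :> R by rewrite invr_gt0.
  exists (hact l, q); split=> //=; first by apply/refl_groupP; exists l.
  move=> i; case: (split_ordP i) => j ->; last first.
    rewrite row_mxEr mxE subr0 (ord1 j) gtr0_norm //.
    by apply: (le_trans c2); rewrite CE' (le_trans c4) // lerDl mulr_ge0 // ltW.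
  rewrite row_mxEl; have L (s w p : R) : `|w - s| <= k.+1%:R^-1 ->
      `|p - w| <= (2 * K + 2) / bend v -> `|p - s| <= C / k.+1%:R.
    move=> h1 h2; have -> : p - s = (p - w) + (w - s) by ring.
    by rewrite CE (le_trans (ler_normD _ _)) // lerD // (le_trans h2).
  case: j => -[|[|//]] j.
    rewrite (_ : Ordinal j = 0); last exact: val_inj.
    by apply: L y0 _; move: c0; rewrite row2E0.
  rewrite (_ : Ordinal j = 1); last exact: val_inj.
  by apply: L y1 _; move: c1; rewrite row2E1.
pose gq k := projT1 (cid (step k)).
have G k := projT2 (cid (step k)); rewrite -/(gq _) in G.
exists (basept N), (fun k => (gq k).1); split; first exact: uhs_basept.
  by move=> k; have [] := G k.
have -> : (fun k => (gq k).1 (pt (basept N))) = (fun k => pt (gq k).2).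
  by apply/funext => k; have [] := G k.
apply/cvg_ptP => e e0; exists (Num.bound (C / e)) => k kb i.
have [_ _ /(_ i)] := G k; move/le_lt_trans; apply.
rewrite ltr_pdivrMr ?ltr0n // mulrC -ltr_pdivrMr //.
have := archi_boundP (ltW (divr_gt0 C0 e0)) => /lt_trans; apply.
by rewrite ltr_nat.
Qed.

Lemma packing_limit_group_limitE :
  packing_limit_set sphere_packing = group_limit_set refl_group.
Proof.
apply/seteqP; split; [exact: packing_limit_group_limit|exact: group_limit_packing_limit].
Qed.

End LimitSet.

(** * Sets of finite hyperbolic volume *)

Section Volume.
Context {R : realType}.
Implicit Types (A B : set 'rV[R]_(2 + 1)) (p q : 'rV[R]_(2 + 1)).

Definition pt3 (a b h : R) : 'rV[R]_(2 + 1) := row_mx (row2 a b) (const_mx h).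

Lemma height_pt3 a b h : height (pt3 a b h) = h.
Proof. by rewrite /height row_mxEr mxE. Qed.

Lemma box_pt3 a b h a' b' h' p : box (pt3 a b h) (pt3 a' b' h') p <->
  [/\ a <= p 0 (lshift 1 0) <= a', b <= p 0 (lshift 1 1) <= b' & h <= height p <= h'].
Proof.
split=> [H|[H0 H1 H2] i].
  have := H (lshift 1 0); have := H (lshift 1 1); have := H (rshift 2 0).
  by rewrite !row_mxEl !row_mxEr !mxE /=.
case: (split_ordP i) => j ->; last by rewrite !row_mxEr !mxE (ord1 j).
rewrite !row_mxEl !mxE; case: j => -[|[|//]] j /=.
  by rewrite (_ : Ordinal j = 0) //; apply: val_inj.
by rewrite (_ : Ordinal j = 1) //; apply: val_inj.
Qed.

Lemma le_pt3 (a b h a' b' h' : R) : a <= a' -> b <= b' -> h <= h' ->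
  forall i, pt3 a b h 0 i <= pt3 a' b' h' 0 i.
Proof.
move=> aa bb hh i; case: (split_ordP i) => j ->; last by rewrite !row_mxEr !mxE.
by rewrite !row_mxEl !mxE; case: ifP.
Qed.

Lemma box_volume_pt3 a b h a' b' h' :
  box_volume (pt3 a b h) (pt3 a' b' h') = (a' - a) * (b' - b) * ((h ^- 2 - h' ^- 2) / 2).
Proof.
rewrite /box_volume !height_pt3 big_ord_recl big_ord1 !row_mxEl.
by rewrite !mxE /=.
Qed.

(** Finite outer volume, with real partial sums bounded uniformly in place of an extended series. *)
Definition boxable A := exists (p q : nat -> 'rV[R]_(2 + 1)) (V : R),
  [/\ forall k, uhs (p k), forall k i, p k 0 i <= q k 0 i,
      A `<=` \bigcup_k box (p k) (q k) &
      forall n, \sum_(k < n) box_volume (p k) (q k) <= V].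

Lemma box_volume_ge0 p q : uhs p -> (forall i, p 0 i <= q 0 i) -> 0 <= box_volume p q.
Proof.
move=> hp pq; rewrite mulr_ge0 ?prodr_ge0 // => [i _|]; first by rewrite subr_ge0.
have hq : height p <= height q by apply: pq.
rewrite divr_ge0 ?ler0n // subr_ge0 lef_pV2 ?posrE ?exprn_gt0 ?(lt_le_trans hp hq) //.
by rewrite ler_pXn2r ?nnegrE ?(ltW (lt_le_trans hp hq)) // ltW.
Qed.

Lemma boxable_hvolume A : boxable A -> (hvolume A < +oo)%E.
Proof.
move=> [p [q [V [hp pq Apq HV]]]].
apply: (@le_lt_trans _ _ V%:E); last by rewrite ltry.
apply: (@le_trans _ _ (\sum_(0 <= k <oo) (box_volume (p k) (q k))%:E)%E).
  by apply: ereal_inf_lbound; exists p, q.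
apply: lime_le; first by apply: is_cvg_nneseries => k _ _; rewrite lee_fin box_volume_ge0.
by apply: nearW => n; rewrite sumEFin lee_fin big_mkord.
Qed.

Lemma boxable_sub A B : A `<=` B -> boxable B -> boxable A.
Proof.
move=> AB [p [q [V [hp pq Bpq HV]]]]; exists p, q, V; split=> //.
exact: subset_trans Bpq.
Qed.

Lemma boxable_setU A B : boxable A -> boxable B -> boxable (A `|` B).
Proof.
move=> [p [q [V [hp pq Apq HV]]]] [p' [q' [V' [hp' pq' Bpq HV']]]].
exists (fun k => if odd k then p' k./2 else p k./2),
  (fun k => if odd k then q' k./2 else q k./2), (V + V'); split.
- by move=> k; case: ifP.
- by move=> k; case: ifP.
- move=> x [/Apq[k _ xk]|/Bpq[k _ xk]].
    by exists k.*2 => //; rewrite odd_double doubleK.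
  by exists k.*2.+1 => //=; rewrite odd_double /= uphalf_double.
- move=> n; pose F (k : nat) := box_volume (if odd k then p' k./2 else p k./2)
    (if odd k then q' k./2 else q k./2).
  have F0 k : 0 <= F k by rewrite /F; case: ifP => _; apply: box_volume_ge0.
  rewrite -(big_mkord xpredT F).
  apply: (@le_trans _ _ (\sum_(0 <= k < n.*2) F k)).
    rewrite [leRHS](big_cat_nat (n := n)) //= ?lerDl ?sumr_ge0 //.
    by rewrite -addnn leq_addr.
  have -> : \sum_(0 <= k < n.*2) F k =
      \sum_(k < n) box_volume (p k) (q k) + \sum_(k < n) box_volume (p' k) (q' k).
    elim: n => [|n IH]; first by rewrite !big_ord0 big_geq // addr0.
    rewrite doubleS !big_nat_recr //= IH !big_ord_recr /= /F /= odd_double /=.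
    by rewrite uphalf_double doubleK; ring.
  exact: lerD.
Qed.

Lemma boxable_set0 : boxable set0.
Proof.
exists (fun=> pt3 0 0 1), (fun=> pt3 0 0 1), 0; split=> //.
  by move=> k; rewrite /uhs /= height_pt3.
by move=> n; rewrite big1 // => i _; rewrite box_volume_pt3 subrr !mul0r.
Qed.

Lemma boxable_bigcup (n : nat) (F : nat -> set 'rV[R]_(2 + 1)) :
  (forall j, (j < n)%N -> boxable (F j)) ->
  boxable [set p | exists2 j : nat, (j < n)%N & F j p].
Proof.
elim: n => [_|n IH H]; first by apply: boxable_sub boxable_set0 => p [].
apply: (@boxable_sub _ ([set p | exists2 j : nat, (j < n)%N & F j p] `|` F n)).
  move=> p [j]; rewrite ltnS leq_eqVlt => /predU1P[->|jn] Fp; first by right.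
  by left; exists j.
apply: boxable_setU; last exact: H.
by apply: IH => j jn; apply: H; apply: ltnW.
Qed.

Lemma sum_half (n : nat) : \sum_(k < n) (2^-1 : R) ^+ k <= 2.
Proof.
suff -> : \sum_(k < n) (2^-1 : R) ^+ k = 2 - 2 * 2^-1 ^+ n.
  by rewrite gerBl mulr_ge0 // exprn_ge0.
elim: n => [|n IH]; first by rewrite big_ord0 expr0; ring.
by rewrite big_ord_recr /= IH exprS; field.
Qed.

Lemma boxable_dyadic A (p q : nat -> 'rV[R]_(2 + 1)) (V : R) :
  (forall k, uhs (p k)) -> (forall k i, p k 0 i <= q k 0 i) ->
  A `<=` \bigcup_k box (p k) (q k) ->
  (forall k, box_volume (p k) (q k) <= V * 2^-1 ^+ k) -> boxable A.
Proof.
move=> hp pq Apq HV; exists p, q, (V * 2); split=> // n.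
have V0 : 0 <= V.
  by have := HV 0%N; rewrite expr0 mulr1; apply: le_trans; apply: box_volume_ge0.
apply: (@le_trans _ _ (\sum_(k < n) V * 2^-1 ^+ k)); first exact: ler_sum.
by rewrite -mulr_sumr ler_wpM2l // sum_half.
Qed.

Lemma dyadic_up (t h : R) : 0 < t -> t <= h -> exists k : nat, t * 2 ^+ k <= h <= t * 2 ^+ k.+1.
Proof.
move=> t0 th; have [n hn] : exists n : nat, h <= t * 2 ^+ n.+1.
  have [n hn] : exists n : nat, h / t <= n%:R.
    by exists (Num.bound (h / t)); rewrite ltW // archi_boundP // divr_ge0 // ?(le_trans (ltW t0)) // ltW.
  exists n; rewrite mulrC -ler_pdivrMr // (le_trans hn) //.
  by rewrite -natrX ler_nat (leq_trans (ltnW (ltn_expl n (ltnSn 1)))) // leq_exp2l.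
elim: n hn => [|n IH] hn; first by exists 0%N; rewrite expr0 mulr1 th.
have [h2|h2] := leP h (t * 2 ^+ n.+1); first exact: IH.
by exists n.+1; rewrite hn ltW.
Qed.

Lemma dyadic_down (t h : R) : 0 < h -> h <= t ->
  exists k : nat, t * 2^-1 ^+ k.+1 <= h <= t * 2^-1 ^+ k.
Proof.
move=> h0 ht; have [k /andP[k1 k2]] := dyadic_up h0 ht; exists k.
have e (n : nat) : (2^-1 ^+ n : R) = (2 ^+ n)^-1 by rewrite exprVn.
by rewrite !e ler_pdivrMr ?exprn_gt0 // ler_pdivlMr ?exprn_gt0 // k1 k2.
Qed.

(** The slice r/2 <= h <= r has base area 4 D r^3 and a density integrating to (3/2) r^-2, hence
    volume 6 D r: a geometric series over dyadic heights. *)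
Lemma boxable_cusp (a b t D : R) (f g : R -> R) :
  0 < t -> (forall r r', 0 < r -> r <= r' -> 0 <= f r <= f r') ->
  (forall r r', 0 < r -> r <= r' -> 0 <= g r <= g r') ->
  (forall r, 0 < r -> f r * g r = D * r ^+ 3) ->
  boxable [set p | [/\ 0 < height p <= t, `|p 0 (lshift 1 0) - a| <= f (height p) &
    `|p 0 (lshift 1 1) - b| <= g (height p)]].
Proof.
move=> t0 fm gm fg.
pose r k := t * 2^-1 ^+ k; have r0 k : 0 < r k by rewrite mulr_gt0 // exprn_gt0.
have rS k : r k.+1 = r k / 2 by rewrite /r exprSr mulrA.
have f0 k : 0 <= f (r k) by have /andP[] := fm _ _ (r0 k) (lexx _).
have g0 k : 0 <= g (r k) by have /andP[] := gm _ _ (r0 k) (lexx _).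
apply: (@boxable_dyadic _ (fun k => pt3 (a - f (r k)) (b - g (r k)) (r k.+1))
  (fun k => pt3 (a + f (r k)) (b + g (r k)) (r k)) (6 * D * t)).
- by move=> k; rewrite /uhs /= height_pt3.
- move=> k; apply: le_pt3; first by have := f0 k; lra.
    by have := g0 k; lra.
  by rewrite rS; have := r0 k; lra.
- move=> p [/andP[h0 ht] pa pb]; have [k kh] := dyadic_down h0 ht.
  rewrite -/(r k) -/(r k.+1) in kh; exists k => //.
  have /andP[_ fk] := fm _ _ h0 (proj2 (andP kh)).
  have /andP[_ gk] := gm _ _ h0 (proj2 (andP kh)).
  apply/box_pt3; split=> //.
    by move: (le_trans pa fk); rewrite ler_norml => /andP[? ?]; apply/andP; split; lra.
  by move: (le_trans pb gk); rewrite ler_norml => /andP[? ?]; apply/andP; split; lra.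
- move=> k; rewrite box_volume_pt3 rS.
  have -> : (a + f (r k) - (a - f (r k))) * (b + g (r k) - (b - g (r k))) =
    4 * (f (r k) * g (r k)) by ring.
  rewrite fg // le_eqVlt; apply/orP; left; apply/eqP.
  have -> : 6 * D * t * 2^-1 ^+ k = 6 * D * r k by rewrite /r; ring.
  by have := r0 k; move: (r k) => s s0; field; rewrite gt_eqF.
Qed.

(** The cusp at infinity: thickening widens the strip linearly in the height, which the cubic decay
    of the density absorbs. *)
Lemma boxable_strip (t L : R) : 0 < t -> 0 <= L ->
  boxable [set p | [/\ t <= height p, 0 <= p 0 (lshift 1 0) <= 2 &
    -1 - height p <= p 0 (lshift 1 1) <= L + height p]].
Proof.
move=> t0 L0; pose r k := t * 2 ^+ k; have r0 k : 0 < r k by rewrite mulr_gt0 // exprn_gt0.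
have rS k : r k.+1 = 2 * r k by rewrite /r exprS mulrCA.
have tr k : t <= r k by rewrite ler_peMr ?exprn_ege1 ?ler1n // ltW.
apply: (@boxable_dyadic _ (fun k => pt3 0 (- 1 - 2 * r k) (r k))
  (fun k => pt3 2 (L + 2 * r k) (r k.+1)) ((L + 1) / t ^+ 2 + 4 / t)).
- by move=> k; rewrite /uhs /= height_pt3.
- move=> k; apply: le_pt3 => //; first by have := r0 k; lra.
  by rewrite rS; have := r0 k; lra.
- move=> p [th x02 /andP[y1 y2]]; have [k kh] := dyadic_up t0 th.
  rewrite -/(r k) -/(r k.+1) in kh; exists k => //.
  apply/box_pt3; split=> //; move: kh; rewrite rS => /andP[k1 k2].
  by apply/andP; split; lra.
- move=> k; rewrite box_volume_pt3 rS.
  have rk : (r k)^-1 = t^-1 * 2^-1 ^+ k by rewrite /r invfM exprVn.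
  have -> : (2 - 0) * (L + 2 * r k - (-1 - 2 * r k)) * ((r k ^- 2 - (2 * r k) ^- 2) / 2) =
     3 / 4 * (L + 1) * (r k)^-1 * (r k)^-1 + 3 * (r k)^-1.
    by have := r0 k; move: (r k) => s s0; field; rewrite gt_eqF.
  have i0 : 0 < (r k)^-1 by rewrite invr_gt0.
  have it : (r k)^-1 <= t^-1 by rewrite lef_pV2 ?posrE.
  have -> : ((L + 1) / t ^+ 2 + 4 / t) * 2^-1 ^+ k = (L + 1) * t^-1 * (r k)^-1 + 4 * (r k)^-1.
    by rewrite rk; field; rewrite gt_eqF.
  have : (L + 1) * (r k)^-1 * (r k)^-1 <= (L + 1) * t^-1 * (r k)^-1.
    by rewrite ler_pM2r // ler_wpM2l // addr_ge0.
  have : 0 <= (L + 1) * (r k)^-1 * (r k)^-1 by rewrite !mulr_ge0 ?addr_ge0 // ltW.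
  lra.
Qed.

End Volume.

(** * Finite volume of the thickened convex core *)

Section GeometricallyFinite.
Context {R : realType} (N : nat).
Hypothesis N0 : (0 < N)%N.
Local Notation mirrors := (@mirrors R N).
Local Notation base := (@base R N).
Local Notation spheres := (@spheres R N).
Local Notation refl_group := (@refl_group R N).
Implicit Types (u v : lvec R) (x : 'rV[R]_2) (y z : Rhat R 2) (p q : 'rV[R]_(2 + 1)).

(** On the hyperboloid a geodesic lies in the plane of two lightlike vectors: its point of parameter
    t is a positive multiple of [blift y] plus t^2 times [blift z]. *)
Lemma geodesic_hyp y z (t : R) : y <> z -> 0 < t ->
  uhs (geodesic y z t) /\ exists2 k, 0 < k & forall v,
    ldot v (hyp (geodesic y z t)) = k * (ldot v (blift y) + t ^+ 2 * ldot v (blift z)).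
Proof.
move=> yz t0; case: y z yz => [a|] [b|] //= ab; last 2 first.
- set p := row_mx _ _.
  have ph : height p = t by rewrite /height row_mxEr mxE eqxx mulr1n.
  have hp : uhs p by rewrite /uhs /= ph.
  split=> //; exists t^-1; first by rewrite invr_gt0.
  by move=> v; rewrite ldotZr ph /ldot /= /p !row_mxEl; field; rewrite gt_eqF.
- set p := row_mx _ _.
  have ph : height p = t^-1 by rewrite /height row_mxEr mxE eqxx mulr1n.
  have hp : uhs p by rewrite /uhs /= ph invr_gt0.
  split=> //; exists t^-1; first by rewrite invr_gt0.
  by move=> v; rewrite ldotZr ph /ldot /= /p !row_mxEl; field; rewrite gt_eqF.
have d0 : 0 < enorm (b - a).
  by apply: enorm_gt0; rewrite subr_eq0; apply/eqP => e; apply: ab; rewrite e.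
have := enorm_sqr (b - a); rewrite dot2 !mxE; set d := enorm _ in d0 * => dE.
have s0 : 0 < 1 + t ^+ 2 by rewrite ltr_wpDr ?sqr_ge0.
set p := _ *: _.
have ph : height p = t * d / (1 + t ^+ 2).
  by rewrite /height /p mxE row_mxEr mxE eqxx mulr1n mulrC.
have pl i : p 0 (lshift 1 i) = (a 0 i + t ^+ 2 * b 0 i) / (1 + t ^+ 2).
  by rewrite /p mxE row_mxEl !mxE mulrC.
have hp : uhs p by rewrite /uhs /= ph divr_gt0 // mulr_gt0.
split=> //; exists (t * d)^-1; first by rewrite invr_gt0 mulr_gt0.
move=> v; rewrite ldotZr ph /ldot /= !pl.
by field: dE; rewrite !gt_eqF.
Qed.

(** The region outside all spheres is [hconvex]: along a geodesic the product with [v] has the sign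
    of A + t^2 B, which is monotone in t, so one of the ends controls the middle. *)
Lemma hull_outside q : hull (group_limit_set refl_group) q ->
  uhs q /\ forall v, spheres v -> ldot v (hyp q) <= 0.
Proof.
apply: (_ : hull _ `<=` [set q | uhs q /\ forall v, spheres v -> ldot v (hyp q) <= 0]).
apply: smallest_sub => [y z t1 t2 t3 yz t10 t12 t23 [h1 H1] [h3 H3]|].
  have t20 := lt_le_trans t10 t12; have t30 := lt_le_trans t20 t23.
  have [h2 [k2 k20 E2]] := geodesic_hyp yz t20; split=> // v Pv.
  have [_ [k1 k10 E1]] := geodesic_hyp yz t10.
  have [_ [k3 k30 E3]] := geodesic_hyp yz t30.
  have := H1 v Pv; have := H3 v Pv; rewrite E1 E2 E3 !pmulr_rle0 //.
  have s12 : t1 ^+ 2 <= t2 ^+ 2 by rewrite ler_pXn2r ?nnegrE // ltW.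
  have s23 : t2 ^+ 2 <= t3 ^+ 2 by rewrite ler_pXn2r ?nnegrE // ltW.
  move: (ldot v (blift y)) (ldot v (blift z)) => A B h h'.
  have [B0|B0] := leP 0 B.
    by apply: le_trans h; rewrite lerD2l ler_wpM2r.
  by apply: le_trans h'; rewrite lerD2l ler_wnM2r // ltW.
move=> _ [y [z [t [Ly Lz yz t0 ->]]]].
have [hq [k k0 E]] := geodesic_hyp yz t0; split=> // v Pv.
rewrite E pmulr_rle0 // -[X in _ <= X]addr0 lerD ?(group_limit_outside N0 Ly Pv) //.
by rewrite pmulr_rle0 ?exprn_gt0 // (group_limit_outside N0 Lz Pv).
Qed.

Definition thick_polyhedron : set 'rV[R]_(2 + 1) := [set p | [/\ uhs p,
  forall a, mirrors a -> ldot a (hyp p) <= 0 & forall b, base b -> ldot b (hyp p) <= 1]].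

(** The radius arcosh (sqrt 2) is arsinh 1, and the product with [v] is the hyperbolic sine of the
    signed distance to its hyperplane. *)
Lemma thickening_bound p v : spheres v ->
  thickening (arcosh (Num.sqrt 2)) (hull (group_limit_set refl_group)) p ->
  ldot v (hyp p) <= 1.
Proof.
move=> Pv [hp [q /hull_outside[hq Hq] pq]]; rewrite leNgt; apply/negP => vp.
move: pq; rewrite hdistE // ltNge => /negP; apply.
apply: arcosh_ge; first by rewrite -[X in X <= _]sqrtr1 ler_wsqrtr // ler1n.
have h1 := hyp_dot_ge1 hp hq.
have h := hyp_gram hp hq (spheres_unit Pv) (le_trans ler01 (ltW vp)) (Hq _ Pv).
rewrite -(ler_pXn2r (ltn0Sn 1)) ?nnegrE ?sqrtr_ge0 ?(le_trans ler01 h1) //.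
rewrite sqr_sqrtr ?ler0n // sqrrN; apply: le_trans h.
have := sqr_ge0 (ldot v (hyp q)).
have : 1 <= ldot v (hyp p) ^+ 2 by rewrite expr_ge1 ?(ltW vp) // (le_trans ler01 (ltW vp)).
lra.
Qed.

Lemma thick_polyhedron_cover :
  @pt R (2 + 1) @` thickening (arcosh (Num.sqrt 2)) (hull (group_limit_set refl_group)) `<=`
  \bigcup_(g in refl_group) g @` (@pt R (2 + 1) @` thick_polyhedron).
Proof.
move=> _ [p tp <-]; have [hp _] := tp.
have [l [q [Al hq pq qE A0]]] := fold_uhs N0 hp.
exists (hact (rev l)).
  by apply/refl_groupP; exists (rev l) => // a; rewrite mem_rev; apply: Al.
exists (pt q); last by rewrite -pq (hactK Al).
exists q => //; split=> // b Bb; rewrite qE -[l]revK -lact_sym.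
apply: thickening_bound tp; apply: orbit_lact (base_spheres Bb) => a.
by rewrite mem_rev; apply: Al.
Qed.

(** Neighborhoods of the ideal vertices, where two mirrors and two base walls touch. The width is
    quadratic in the height between the tangent mirrors, but only linear between the thickened base
    walls. *)
Definition vcusp (a b : R) : set 'rV[R]_(2 + 1) := [set p | [/\ 0 < height p <= 64^-1,
  `|p 0 (lshift 1 0) - a| <= 200 * height p & `|p 0 (lshift 1 1) - b| <= 200 * height p ^+ 2]].
Definition hcusp (a b : R) : set 'rV[R]_(2 + 1) := [set p | [/\ 0 < height p <= 64^-1,
  `|p 0 (lshift 1 0) - a| <= 200 * height p ^+ 2 & `|p 0 (lshift 1 1) - b| <= 200 * height p]].

Lemma boxable_vcusp a b : boxable (vcusp a b).
Proof.
apply: (@boxable_cusp R a b 64^-1 (200 * 200) (fun r => 200 * r) (fun r => 200 * r ^+ 2)).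
- by rewrite invr_gt0.
- by move=> r r' r0 rr; apply/andP; split; lra.
- move=> r r' r0 rr; have : r ^+ 2 <= r' ^+ 2.
    by rewrite ler_pXn2r ?nnegrE ?(ltW r0) // (le_trans (ltW r0)).
  by have := sqr_ge0 r => ? ?; apply/andP; split; lra.
- by move=> r r0; ring.
Qed.

Lemma boxable_hcusp a b : boxable (hcusp a b).
Proof.
apply: (@boxable_cusp R a b 64^-1 (200 * 200) (fun r => 200 * r ^+ 2) (fun r => 200 * r)).
- by rewrite invr_gt0.
- move=> r r' r0 rr; have : r ^+ 2 <= r' ^+ 2.
    by rewrite ler_pXn2r ?nnegrE ?(ltW r0) // (le_trans (ltW r0)).
  by have := sqr_ge0 r => ? ?; apply/andP; split; lra.
- by move=> r r' r0 rr; apply/andP; split; lra.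
- by move=> r r0; ring.
Qed.

(* [x] and [y] are the horizontal and vertical distances of a point at height [t]
   to the center of a base circle. *)
Lemma cell_cusps (x y t : R) : 0 < t -> t <= 64^-1 -> 0 <= x <= 1 -> 0 <= y <= 1 + t ->
  1 <= (1 - x) ^+ 2 + (1 - y) ^+ 2 + t ^+ 2 -> 1 - 2 * t <= x ^+ 2 + y ^+ 2 + t ^+ 2 ->
  (x <= 200 * t ^+ 2 /\ `|y - 1| <= 200 * t) \/
  (1 - x <= 200 * t /\ y <= 200 * t ^+ 2).
Proof.
move=> t0 t1 /andP[x0 x1] /andP[y0 y1] A B.
have tt : t * t <= t / 64 by rewrite ler_pM2l.
have xx : 0 <= x * (1 - x) by apply: mulr_ge0; lra.
have yy : 0 <= y * (1 + t - y) by apply: mulr_ge0; lra.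
have yt : y * t <= (1 + t) * t by rewrite ler_pM2r.
(* The mirror (A) bounds x + y by about 1 and the base wall (B) bounds x^2 + y^2 from below by about
   1, so x is near 0 or 1: these are the two kinds of cusps. *)
have S1 : x + y <= 1 + 3 * t by lra.
have xt : x * (1 - x) <= 8 * t by lra.
have [xh|xh] := leP x 2^-1.
  left; have x16 : x <= 16 * t.
    have : 0 <= x * (2^-1 - x) by apply: mulr_ge0; lra.
    lra.
  have x2 : x * x <= 16 * t * (16 * t) by rewrite ler_pM.
  have yh : 2^-1 <= y.
    rewrite leNgt; apply/negP => yh; have : y * y <= 2^-1 * 2^-1 by rewrite ler_pM // ltW.
    lra.
  have y12 : 1 - y <= 12 * t.
    have : 0 <= (1 - y) * (y - 2^-1) \/ 1 - y <= 0.
      by have [?|?] := leP (1 - y) 0; [right|left; apply: mulr_ge0; lra].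
    by case; lra.
  have y2 : (1 - y) ^+ 2 <= (12 * t) ^+ 2.
    by rewrite sqr_le_norm // ler_norml; apply/andP; split; lra.
  split; last by rewrite ler_norml; apply/andP; split; lra.
  have : 0 <= x * (2^-1 - x) by apply: mulr_ge0; lra.
  have := sqr_ge0 t; lra.
right; have x16 : 1 - x <= 16 * t.
  have : 0 <= (1 - x) * (x - 2^-1) by apply: mulr_ge0; lra.
  lra.
split; first lra.
(* As t <= 1/64, y stays below 1/2. Inserting the linear bounds into A then gives (3/2) y <= (16^2 +
   1) t^2, which the constant 200 covers. *)
have y19 : y <= 19 * t by lra.
have x2 : (1 - x) ^+ 2 <= (16 * t) ^+ 2.
  by rewrite sqr_le_norm // ger0_norm //; lra.
have : 0 <= y * (2^-1 - y) by apply: mulr_ge0; lra.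
have := sqr_ge0 t; lra.
Qed.

Lemma boxable_thick_polyhedron : boxable thick_polyhedron.
Proof.
have N1 : 1 <= (N%:R : R) by rewrite ler1n.
pose cusps (j : nat) := vcusp 1 (2 * j%:R) `|` (hcusp 0 (2 * j%:R - 1) `|`
  (hcusp 0 (2 * j%:R + 1) `|` (hcusp 2 (2 * j%:R - 1) `|` hcusp 2 (2 * j%:R + 1)))).
pose strip := [set p : 'rV[R]_(2 + 1) | [/\ 64^-1 <= height p, 0 <= p 0 (lshift 1 0) <= 2 &
    -1 - height p <= p 0 (lshift 1 1) <= 2 * N%:R - 1 + height p]].
apply: (@boxable_sub R _ (strip `|` [set p | exists2 j : nat, (j < N)%N & cusps j p])); last first.
  apply: boxable_setU; first by apply: boxable_strip; [rewrite invr_gt0|lra].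
  apply: boxable_bigcup => j _; apply: boxable_setU; first exact: boxable_vcusp.
  by do 3?[apply: boxable_setU]; apply: boxable_hcusp.
move=> p [hp A0 B1]; have h0 : 0 < height p by [].
have sgn (c d e : R) : ldot (LVec 0 c d e) (hyp p) <= 0 ->
    d * p 0 (lshift 1 0) + e * p 0 (lshift 1 1) - c / 2 <= 0.
  by move=> h; rewrite -line_hyp // mulr_ge0_le0 // ltW.
have sgn1 (c d e : R) : ldot (LVec 0 c d e) (hyp p) <= 1 ->
    d * p 0 (lshift 1 0) + e * p 0 (lshift 1 1) - c / 2 <= height p.
  by move=> h; rewrite -line_hyp // ger_pMr.
have x0 := sgn _ _ _ (A0 _ (Or31 _ _ erefl)).
have x2 := sgn _ _ _ (A0 _ (Or32 _ _ erefl)).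
have y0 := sgn1 _ _ _ (B1 _ (@lower_base R N)).
have y1 := sgn1 _ _ _ (B1 _ (@upper_base R N)).
have xr : 0 <= p 0 (lshift 1 0) <= 2 by apply/andP; split; lra.
have [t1|t1] := leP 64^-1 (height p).
  by left; split=> //; apply/andP; split; lra.
right; have cp := circ_hyp _ _ hp.
have [||j jN jy] := @row_choice R N N0 (p 0 (lshift 1 1)) (height p) (ltW h0); [lra|lra|].
have [c cx] := column_choice xr.
have [m [Am [ex ey]]] := mirror_choice (p 0 (lshift 1 1)) jN xr cx.
have am : 2 * height p * ldot (circ 1 m) (hyp p) <= 0.
  by rewrite pmulr_rle0 ?A0 // mulr_gt0.
have bm : 2 * height p * ldot (circ (2 * c%:R) (2 * j%:R)) (hyp p) <= 2 * height p.
  by rewrite ger_pMr ?mulr_gt0 //; apply: B1; apply: Or33; exists c, j.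
rewrite !cp ex ey in am bm.
exists j => //.
have [||||[xs ys]|[xs ys]] := @cell_cusps `|p 0 (lshift 1 0) - 2 * c%:R|
    `|p 0 (lshift 1 1) - 2 * j%:R| (height p) h0 (ltW t1).
- by rewrite normr_ge0.
- by rewrite normr_ge0.
- lra.
- by rewrite !real_normK ?num_real //; lra.
- right; have hh : 0 < height p <= 64^-1 by rewrite h0 ltW.
  have cE : 2 * c%:R = 0 :> R \/ 2 * c%:R = 2 :> R.
    by case: (c); [right; rewrite mulr1|left; rewrite mulr0].
  have [yj|yj] := leP 0 (p 0 (lshift 1 1) - 2 * j%:R).
    rewrite (ger0_norm yj) in ys.
    have e : p 0 (lshift 1 1) - (2 * j%:R + 1) = p 0 (lshift 1 1) - 2 * j%:R - 1 by ring.
    by case: cE => cE; rewrite cE in xs; right; [left|right; right]; split; rewrite ?e.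
  rewrite (ltr0_norm yj) -normrN in ys.
  have e : p 0 (lshift 1 1) - (2 * j%:R - 1) = - (- (p 0 (lshift 1 1) - 2 * j%:R) - 1) by ring.
  by case: cE => cE; rewrite cE in xs; [left|right; right; left]; split; rewrite ?e.
- left; split=> //; first by rewrite h0 ltW.
  rewrite -(ler_pXn2r (ltn0Sn 1)) ?nnegrE ?mulr_ge0 ?(ltW h0) //.
  rewrite real_normK ?num_real // ex sqr_le_norm // ger0_norm //; lra.
Qed.

Lemma refl_group_geometrically_finite : geometrically_finite refl_group.
Proof.
exists (arcosh (Num.sqrt 2)).
  by apply: arcosh_gt0; rewrite -[X in X < _]sqrtr1 ltr_sqrt // ltr1n.
apply: le_lt_trans (boxable_hvolume boxable_thick_polyhedron).
apply: ereal_inf_lbound; exists thick_polyhedron => //; split; first by move=> p [].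
exact: thick_polyhedron_cover.
Qed.

End GeometricallyFinite.

Theorem theorem3 (R : realType) :
  exists P : nat -> collection R,
    (forall i, [/\ (2 <= projT1 (P i))%N,
                   packing (projT2 (P i)),
                   integral_packing (projT2 (P i)) &
                   crystallographic (projT2 (P i))]) /\
    (forall i j, i <> j -> ~ conformally_equivalent (P i) (P j)).
Proof.
(* The index is shifted because the rectangle requires N >= 1. *)
exists (fun i => existT _ 2 (@sphere_packing R i.+1)); split=> [i|i j ij].
  split=> //=.
  - exact: sphere_packing_packing.
  - exact: sphere_packing_integral.
  - exists (@refl_group R i.+1); split.
    + exact: refl_group_reflection.
    + exact: refl_group_geometrically_finite.
    + exact: packing_limit_group_limitE.
by apply: sphere_packings_inequivalent => // -[].
Qed.
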